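(* Let $A\in\mathbb{R}^{n\times n}$, $B\in\mathbb{R}^{n\times m}$, $D=\Gamma\Gamma^{\top}$ with $\Gamma\in\mathbb{R}^{n\times r}$, $Q\in\mathbb{S}^n$ with $Q\succeq0$, $R\in\mathbb{S}^m$ with $R\succ0$, $\varpi\ge0$, and $\Sigma_0,\Sigma_{\rm f}\in\mathbb{S}^n_{++}$ with $\Sigma_0\neq\Sigma_{\rm f}$; assume $(A,B)$ is controllable and that the asymptotic point convergence assumption (defined in the context) holds. Assume that one of the following conditions holds: (a) $\varpi>0$; (b) $Q\succeq0$ and $Q\ne0$; (c) the Lyapunov equation $A\Sigma_{\rm s}+\Sigma_{\rm s}A^{\top}+D=0$ admits no positive-definite solution $\Sigma_{\rm s}$. Then the free-final-time covariance steering problem (Problem 2 of the context) admits at least one finite candidate free-final-time minimizer, i.e. there exists $t_{\rm c}\in(0,+\infty)$ satisfying the transversality condition $\mathrm{H}_{t_{\rm c}}=0$.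
   Context: $\mathbb{S}^n$ denotes the real symmetric $n\times n$ matrices and $\mathbb{S}^n_{++}$ the positive-definite ones. Admissible gains $\mathcal{K}$: functions $K:[0,+\infty)\to\mathbb{R}^{m\times n}$ that are piecewise continuous on every compact subinterval of $[0,+\infty)$. Problem 2: minimize over $t_{\rm f}>0$ and $K\in\mathcal{K}$ the cost $J(t_{\rm f},K)=\tfrac12\int_0^{t_{\rm f}}\left(\varpi+\operatorname{tr}(Q\Sigma(t))+\operatorname{tr}(K(t)^{\top}RK(t)\Sigma(t))\right)dt$ subject to $\dot\Sigma=(A+BK)\Sigma+\Sigma(A+BK)^{\top}+D$, $\Sigma(0)=\Sigma_0$, $\Sigma(t_{\rm f})=\Sigma_{\rm f}$. Fixed-final-time problem: for fixed $t_{\rm f}\in(0,+\infty)$, minimize $J(t_{\rm f},K)$ over $K$ only. It is known that for every $t_{\rm f}>0$ the boundary value problem $$\dot\Pi=-Q-A^{\top}\Pi-\Pi A+\Pi BR^{-1}B^{\top}\Pi,$$ $$\dot\Sigma=(A-BR^{-1}B^{\top}\Pi)\Sigma+\Sigma(A-BR^{-1}B^{\top}\Pi)^{\top}+D,\quad \Sigma(0)=\Sigma_0,\ \Sigma(t_{\rm f})=\Sigma_{\rm f}$$ ($\Pi(0),\Pi(t_{\rm f})$ free) has a unique solution on $[0,t_{\rm f}]$, denoted $(\Sigma_{t_{\rm f}}(\cdot),\Pi_{t_{\rm f}}(\cdot))$, with values in $\mathbb{S}^n_{++}\times\mathbb{S}^n$; it is the optimal covariance/co-state pair, with optimal gain $K=-R^{-1}B^{\top}\Pi_{t_{\rm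 f}}$. Hamiltonian: $\mathrm{H}(\Sigma,\Pi)=\tfrac12\varpi+\operatorname{tr}(\tfrac12Q\Sigma+\Pi A\Sigma)-\operatorname{tr}(\tfrac12\Pi BR^{-1}B^{\top}\Pi\Sigma-\tfrac12\Pi D)$. $\mathrm{H}_{t_{\rm f}}:=\mathrm{H}(\Sigma_{t_{\rm f}}(t),\Pi_{t_{\rm f}}(t))$, which does not depend on $t\in[0,t_{\rm f}]$. A finite candidate free-final-time minimizer is a $t_{\rm c}\in(0,+\infty)$ satisfying the transversality condition $\mathrm{H}_{t_{\rm c}}=0$ (a ''Hamiltonian-zero''). Asymptotic point convergence assumption: the limiting trajectory $\Sigma_\star(t)=\lim_{t_{\rm f}\to+\infty}\Sigma_{t_{\rm f}}(t)$, $t\ge0$, of the family of optimal covariance trajectories exists (pointwise in $t$) and has a bounded positive-definite limit: $\lim_{t\to+\infty}\Sigma_\star(t)=\Sigma_\infty\succ0$. *)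

(* Defs.v *)
From HB Require Import structures.
From mathcomp Require Import all_boot all_order all_algebra.
From mathcomp Require Import all_classical all_reals all_analysis.

Set Implicit Arguments.
Unset Strict Implicit.
Unset Printing Implicit Defensive.

Import Order.TTheory GRing.Theory Num.Theory.
Import numFieldNormedType.Exports.

Local Open Scope classical_set_scope.
Local Open Scope ring_scope.

Definition mx_symmetric (R : realType) (n : nat) (M : 'M[R]_n) : Prop :=
  M^T = M.

Definition mx_psd (R : realType) (n : nat) (M : 'M[R]_n) : Prop :=
  mx_symmetric M /\ forall x : 'cV[R]_n, 0 <= (x^T *m M *m x) 0 0.

Definition mx_posdef (R : realType) (n : nat) (M : 'M[R]_n) : Prop :=
  mx_symmetric M /\
  forall x : 'cV[R]_n, x != 0 -> 0 < (x^T *m M *m x) 0 0.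

(* The Kalman matrix [B, A B, ..., A^(n-1) B] has rank n. *)
Definition controllable (R : realType) (n m : nat)
    (A : 'M[R]_n) (B : 'M[R]_(n, m)) : Prop :=
  \rank (\mxrow_(i < n) (A ^+ i *m B)) = n.

(* [Rw] is the control weight (the letter R being the real field).  A solution
   on [0, tf] is continuous on the closed interval and satisfies the equations
   on the open one; nothing is said about [S] and [P] outside [0, tf].  The
   end values of [P] are free. *)
Definition bvp_solution (R : realType) (n m : nat)
    (A : 'M[R]_n) (B : 'M[R]_(n, m)) (D Q : 'M[R]_n) (Rw : 'M[R]_m)
    (Sigma0 Sigmaf : 'M[R]_n) (tf : R) (S P : R -> 'M[R]_n) : Prop :=
  [/\ {within `[0, tf], continuous S} /\ {within `[0, tf], continuous P},
      forall t : R, 0 <= t <= tf -> mx_posdef (S t) /\ mx_symmetric (P t),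
      forall t : R, 0 < t < tf ->
        is_derive t 1 P
          (- Q - A^T *m P t - P t *m A
           + P t *m B *m invmx Rw *m B^T *m P t),
      forall t : R, 0 < t < tf ->
        is_derive t 1 S
          ((A - B *m invmx Rw *m B^T *m P t) *m S t
           + S t *m (A - B *m invmx Rw *m B^T *m P t)^T + D)
    & S 0 = Sigma0 /\ S tf = Sigmaf].

Definition unique_bvp_solution (R : realType) (n m : nat)
    (A : 'M[R]_n) (B : 'M[R]_(n, m)) (D Q : 'M[R]_n) (Rw : 'M[R]_m)
    (Sigma0 Sigmaf : 'M[R]_n) (tf : R) (S P : R -> 'M[R]_n) : Prop :=
  bvp_solution A B D Q Rw Sigma0 Sigmaf tf S P /\
  forall S' P' : R -> 'M[R]_n,
    bvp_solution A B D Q Rw Sigma0 Sigmaf tf S' P' ->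
    forall t : R, 0 <= t <= tf -> S' t = S t /\ P' t = P t.

Definition hamiltonian (R : realType) (n m : nat)
    (A : 'M[R]_n) (B : 'M[R]_(n, m)) (D Q : 'M[R]_n) (Rw : 'M[R]_m)
    (varpi : R) (S P : 'M[R]_n) : R :=
  2^-1 * varpi + \tr (2^-1 *: (Q *m S) + P *m A *m S)
  - \tr (2^-1 *: (P *m B *m invmx Rw *m B^T *m P *m S) - 2^-1 *: (P *m D)).

(* [Sigma tf] is the optimal covariance trajectory for final time [tf].  For
   each fixed t only the values [Sigma tf t] with tf >= t matter. *)
Definition asymptotic_point_convergence (R : realType) (n : nat)
    (Sigma : R -> R -> 'M[R]_n) : Prop :=
  exists (Sstar : R -> 'M[R]_n) (Sinf : 'M[R]_n),
    [/\ forall t : R, 0 <= t -> Sigma tf t @[tf --> +oo] --> Sstar t,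
        Sstar t @[t --> +oo] --> Sinf
      & mx_posdef Sinf].

(* The Hamiltonian is constant along a solution of the boundary value problem,
   so "H_tc = 0" is expressed as its vanishing on the whole of [0, tc]. *)
Definition candidate_free_final_time (R : realType) (n m : nat)
    (A : 'M[R]_n) (B : 'M[R]_(n, m)) (D Q : 'M[R]_n) (Rw : 'M[R]_m)
    (varpi : R) (Sigma Pi : R -> R -> 'M[R]_n) (tc : R) : Prop :=
  0 < tc /\
  forall t : R, 0 <= t <= tc ->
    hamiltonian A B D Q Rw varpi (Sigma tc t) (Pi tc t) = 0.

(* Main.v *)
(* Write G = B R^-1 B^T.  Along the optimal pair of the problem on [0, s],
   completing the squares gives a strong duality: the optimal cost J(s) is the
   maximum, over the terminal values P of symmetric Riccati solutions on [0, s],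
   of a functional d(s, P), and the duality gap between two Riccati solutions is
   the integral of tr (E G E Sigma), where E is their difference.  Uniqueness of
   the boundary value problem makes the maximiser P_s unique.  A maximum over a
   small ball around P_s stays interior when s moves a little, and an interior
   maximiser again solves the boundary value problem; so P_s, and with it the
   Hamiltonian H_s, is continuous in s.  Moreover d(., P_s) touches J from below
   at s with slope H_s.
   If H_s never vanished it would have a constant sign.  If H > 0, then J would
   be nondecreasing, but J(s) -> +oo as s -> 0+ because Sigma0 <> Sigmaf (test
   with P = lambda (Sigma0 - Sigmaf)).  If H < 0, then J would be bounded on
   [1, +oo[.  But conditions (a), (b), (c) provide a symmetric P with
   H(Sigma_oo, P) > 0, so by duality on a short time window every trajectory
   staying close to Sigma_oo pays at least a fixed cost on each such window, and
   for large final times there are arbitrarily many of them. *)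

Require Import Defs.
From HB Require Import structures.
From mathcomp Require Import all_boot all_order all_algebra.
From mathcomp Require Import all_classical all_reals all_analysis.
From mathcomp Require Import ring lra.

Set Implicit Arguments.
Unset Strict Implicit.
Unset Printing Implicit Defensive.

Import Order.TTheory GRing.Theory Num.Theory.
Import numFieldNormedType.Exports.

Local Open Scope classical_set_scope.
Local Open Scope ring_scope.

(** * Limits and derivatives of matrix functions *)

(** The unknown is reduced to one symmetric matrix, the terminal co-state. A Riccati solution is a
    quotient [Y X^-1] of blocks of a linear flow with constant coefficients, so existence, absence
    of escape and Lipschitz dependence on the terminal value all become questions about the
    invertibility of [X], and the boundary value problem becomes one equation in [P]: the covariance
    driven by [P] must hit [Sf]. The obstacle is the dependence on the final time. Nothing is known
    in advance about the regularity of the optimal pair in [s], the set of terminal values without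
    escape varies with [s], and the cost need not be differentiable. Hence only local comparisons
    are made. At fixed [P] the dual functional is differentiable in [s]. At fixed [s] its gradient
    in [P] is the terminal mismatch [S s - Sf], with a quadratic remainder, which is why an interior
    maximiser hits the target. Cost, dual functional and Hamiltonian are all doubled inside the
    proof, which removes the halves; [hamiltonianE] restores the factor. *)

Lemma mx_cvgP (R : realType) (T : Type) (F : set_system T) {FF : Filter F}
    (m n : nat) (f : T -> 'M[R]_(m, n)) (M : 'M[R]_(m, n)) :
  f x @[x --> F] --> M <-> forall i j, f x i j @[x --> F] --> M i j.
Proof.
split=> [fM i j|fM].
  exact: (cvg_comp _ _ fM (@coord_continuous _ _ _ i j M)).
apply/cvgrPdist_le => e e0; near=> x.
rewrite [leLHS]/Num.Def.normr/= mx_normrE (bigmax_le _ (ltW e0))//= => ij _.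
rewrite !mxE; move: ij; near: x; apply: filter_forall => -[i j].
exact: ((cvgrPdist_le _ _).1 (fM i j)).
Unshelve. all: by end_near. Qed.

Section MatrixLimits.
Variables (R : realType) (T : Type) (F : set_system T).
Context {FF : Filter F}.

Lemma cvg_bigsum (I : Type) (r : seq I) (P : pred I) (f : I -> T -> R)
    (l : I -> R) : (forall i, f i x @[x --> F] --> l i) ->
  \sum_(i <- r | P i) f i x @[x --> F] --> \sum_(i <- r | P i) l i.
Proof.
move=> fl; elim: r => [|i r IHr].
  by rewrite big_nil; under eq_fun do rewrite big_nil; exact: cvg_cst.
rewrite big_cons; under eq_fun do rewrite big_cons.
by case: (P i) => //; apply: cvgD.
Qed.

Lemma cvg_bigprod (I : Type) (r : seq I) (P : pred I) (f : I -> T -> R)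
    (l : I -> R) : (forall i, f i x @[x --> F] --> l i) ->
  \prod_(i <- r | P i) f i x @[x --> F] --> \prod_(i <- r | P i) l i.
Proof.
move=> fl; elim: r => [|i r IHr].
  by rewrite big_nil; under eq_fun do rewrite big_nil; exact: cvg_cst.
rewrite big_cons; under eq_fun do rewrite big_cons.
by case: (P i) => //; apply: cvgM.
Qed.

Lemma cvg_mulmx (m n p : nat) (f : T -> 'M[R]_(m, n)) (g : T -> 'M[R]_(n, p))
    (M : 'M[R]_(m, n)) (N : 'M[R]_(n, p)) :
  f x @[x --> F] --> M -> g x @[x --> F] --> N ->
  f x *m g x @[x --> F] --> M *m N.
Proof.
move=> /mx_cvgP fM /mx_cvgP gN; apply/mx_cvgP => i j; rewrite mxE.
by under eq_fun do rewrite mxE; apply: cvg_bigsum => k; exact: cvgM.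
Qed.

Lemma cvg_trmx (m n : nat) (f : T -> 'M[R]_(m, n)) (M : 'M[R]_(m, n)) :
  f x @[x --> F] --> M -> (f x)^T @[x --> F] --> M^T.
Proof.
move=> /mx_cvgP fM; apply/mx_cvgP => i j; rewrite mxE.
by under eq_fun do rewrite mxE; exact: fM.
Qed.

Lemma cvg_mxtrace (n : nat) (f : T -> 'M[R]_n) (M : 'M[R]_n) :
  f x @[x --> F] --> M -> \tr (f x) @[x --> F] --> \tr M.
Proof. by move=> /mx_cvgP fM; apply: cvg_bigsum => i; exact: fM. Qed.

Lemma cvg_det (n : nat) (f : T -> 'M[R]_n) (M : 'M[R]_n) :
  f x @[x --> F] --> M -> \det (f x) @[x --> F] --> \det M.
Proof.
move=> /mx_cvgP fM; apply: cvg_bigsum => s.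
by apply: cvgM; [exact: cvg_cst|apply: cvg_bigprod => i; exact: fM].
Qed.

Lemma cvg_near_unitmx (n : nat) (f : T -> 'M[R]_n) (M : 'M[R]_n) :
  f x @[x --> F] --> M -> M \in unitmx -> \forall x \near F, f x \in unitmx.
Proof.
rewrite unitmxE unitfE => /cvg_det fM M0; near=> x.
rewrite unitmxE unitfE; near: x; exact: (cvgr_neq0 _ fM).
Unshelve. all: by end_near. Qed.

Lemma cvg_invmx (n : nat) (f : T -> 'M[R]_n) (M : 'M[R]_n) :
  f x @[x --> F] --> M -> M \in unitmx -> invmx (f x) @[x --> F] --> invmx M.
Proof.
move=> fM Mu; have fu := cvg_near_unitmx fM Mu.
rewrite /invmx Mu; apply: (@cvg_trans _ ((\det (f x))^-1 *: \adj (f x) @[x --> F])).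
  by apply: near_eq_cvg; near=> x; rewrite ifT//; near: x.
apply: cvgZ.
  by apply: cvgV; [move: Mu; rewrite unitmxE unitfE|exact: cvg_det].
apply/mx_cvgP => i j; rewrite !mxE; under eq_fun do rewrite !mxE.
apply: cvgM; first exact: cvg_cst.
apply: cvg_det; apply/mx_cvgP => k l; rewrite !mxE.
by under eq_fun do rewrite !mxE; move/mx_cvgP : fM; exact.
Unshelve. all: by end_near. Qed.

End MatrixLimits.

Section MatrixDerivatives.
Variable R : realType.
Implicit Types t : R.

Lemma is_deriveP (V : normedModType R) (f : R -> V) t (l : V) :
  is_derive t 1 f l <-> h^-1 *: (f (h + t) - f t) @[h --> 0^'] --> l.
Proof.
have E : (fun h : R => h^-1 *: (f (h + t) - f t)) =
    (fun h => h^-1 *: ((f \o shift t) (h *: (1:R)) - f t)).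
  by apply/funext => h /=; rewrite [h *: 1]mulr1.
rewrite E; split=> [[df dl]|fl].
  by rewrite -dl; exact: df.
apply: DeriveDef; first by apply/cvg_ex; exists l.
exact: cvg_lim.
Qed.

Lemma is_derive_continuous (V : normedModType R) (f : R -> V) t (l : V) :
  is_derive t 1 f l -> {for t, continuous f}.
Proof. by move=> [/derivable1_diffP df _]; exact: differentiable_continuous. Qed.

Lemma is_derive_cvg0 (V : normedModType R) (f : R -> V) t (l : V) :
  is_derive t 1 f l -> f (h + t) @[h --> 0^'] --> f t.
Proof.
move=> /is_derive_continuous ft; apply: (@cvg_comp _ _ _ _ _ _ (nbhs t)) ft.
have : h + t @[h --> (0:R)^'] --> 0 + t.
  by apply: cvgD; [exact: nbhs_dnbhs|exact: cvg_cst].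
by rewrite add0r.
Qed.

(** This rule and the next ones are stated for explicit [fun x => ...] and declared as instances, so
    that a whole matrix expression is differentiated by resolution and [is_derive_eq] leaves only an
    algebraic identity. *)
Global Instance is_derive_const (V : normedModType R) (a : V) t :
  is_derive t 1 (fun _ => a) 0.
Proof. exact: is_derive_cst. Qed.

Global Instance is_derive_add (V : normedModType R) (f g : R -> V) t df dg :
  is_derive t 1 f df -> is_derive t 1 g dg ->
  is_derive t 1 (fun x => f x + g x) (df + dg).
Proof. exact: is_deriveD. Qed.

Global Instance is_derive_opp (V : normedModType R) (f : R -> V) t df :
  is_derive t 1 f df -> is_derive t 1 (fun x => - f x) (- df).
Proof. exact: is_deriveN. Qed.

Global Instance is_derive_mul (f g : R -> R) t df dg :
  is_derive t 1 f df -> is_derive t 1 g dg ->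
  is_derive t 1 (fun x => f x * g x) (df * g t + f t * dg).
Proof.
move=> Df Dg; apply: is_derive_eq (is_deriveM Df Dg) _.
by rewrite [LHS]addrC mulrC.
Qed.

Global Instance is_derive_mulmx (m n p : nat) (f : R -> 'M[R]_(m, n))
    (g : R -> 'M[R]_(n, p)) t df dg :
  is_derive t 1 f df -> is_derive t 1 g dg ->
  is_derive t 1 (fun x => f x *m g x) (df *m g t + f t *m dg).
Proof.
move=> Df Dg; apply/is_deriveP.
have E : (fun h : R => h^-1 *: (f (h + t) *m g (h + t) - f t *m g t)) =
    (fun h => h^-1 *: (f (h + t) - f t) *m g t +
              f (h + t) *m (h^-1 *: (g (h + t) - g t))).
  apply/funext => h; rewrite -scalemxAl -scalemxAr -scalerDr; congr (_ *: _).
  by rewrite mulmxBl mulmxBr [RHS]addrC addrA subrK.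
rewrite E; apply: cvgD; apply: cvg_mulmx.
- exact/is_deriveP.
- exact: cvg_cst.
- exact: is_derive_cvg0.
- exact/is_deriveP.
Qed.

Global Instance is_derive_trmx (m n : nat) (f : R -> 'M[R]_(m, n)) t df :
  is_derive t 1 f df -> is_derive t 1 (fun x => (f x)^T) df^T.
Proof.
move=> /is_deriveP Df; apply/is_deriveP.
apply: cvg_trans (cvg_trmx Df); apply: near_eq_cvg; near=> h.
by rewrite linearZ linearB.
Unshelve. all: by end_near.
Qed.

Global Instance is_derive_mxtrace (n : nat) (f : R -> 'M[R]_n) t df :
  is_derive t 1 f df -> is_derive t 1 (fun x => \tr (f x)) (\tr df).
Proof.
move=> /is_deriveP Df; apply/is_deriveP.
apply: cvg_trans (cvg_mxtrace Df); apply: near_eq_cvg; near=> h.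
by rewrite linearZ linearB.
Unshelve. all: by end_near.
Qed.

Lemma is_derive_invmx (n : nat) (f : R -> 'M[R]_n) t df :
  is_derive t 1 f df -> f t \in unitmx ->
  is_derive t 1 (fun x => invmx (f x))
    (- (invmx (f t) *m df *m invmx (f t)) : 'M[R]_n).
Proof.
move=> Df ft; apply/is_deriveP; have f0 := is_derive_cvg0 Df.
have fu := cvg_near_unitmx f0 ft.
(* The resolvent identity [U^-1 - V^-1 = - U^-1 (U - V) V^-1], valid once [f (h + t)] is invertible,
   rewrites the difference quotient. *)
apply: (@cvg_trans _ (- (invmx (f (h + t)) *m (h^-1 *: (f (h + t) - f t)) *m
   invmx (f t)) @[h --> 0^'])).
  apply: near_eq_cvg; near=> h.
  rewrite -scalemxAr -scalemxAl -scalerN; congr (_ *: _).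
  have fhu : f (h + t) \in unitmx by near: h; exact: fu.
  rewrite mulmxBr mulmxBl mulVmx//.
  by rewrite mul1mx -mulmxA mulmxV// mulmx1 opprB.
apply: cvgN; apply: cvg_mulmx; last exact: cvg_cst.
by apply: cvg_mulmx; [exact: cvg_invmx|exact/is_deriveP].
Unshelve. all: by end_near. Qed.

Lemma is_derive_mxP (m n : nat) (f : R -> 'M[R]_(m, n)) t df :
  is_derive t 1 f df <->
  forall i j, is_derive t 1 (fun x => f x i j) (df i j).
Proof.
split=> [/is_deriveP/mx_cvgP Df i j|Df]; apply/is_deriveP.
  by have := Df i j; under eq_fun do rewrite !mxE.
apply/mx_cvgP => i j; under eq_fun do rewrite !mxE.
by move/is_deriveP : (Df i j).
Qed.

Lemma is_derive_reflect (f : R -> R) (s t df : R) :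
  is_derive (s - t) 1 f df -> is_derive t 1 (fun x => f (s - x)) (- df).
Proof.
move=> Df; have Dg : is_derive t 1 (fun x => s - x : R) (-1).
  apply: is_derive_eq (is_deriveB (is_derive_cst s t 1) (is_derive_id t 1)) _.
  by rewrite sub0r.
by have := @is_derive1_comp _ f (fun x => s - x) t _ _ Df Dg; rewrite mulrN1.
Qed.

Lemma is_derive_mx_reflect (m n : nat) (f : R -> 'M[R]_(m, n)) (s t : R) df :
  is_derive (s - t) 1 f df -> is_derive t 1 (fun x => f (s - x)) (- df).
Proof.
move=> /is_derive_mxP Df; apply/is_derive_mxP => i j; rewrite mxE.
exact: (is_derive_reflect (Df i j)).
Qed.

End MatrixDerivatives.

(** * Positive semidefinite matrices *)

Section PositiveMatrices.
Variable R : realType.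


Lemma diag_quad_form (n m : nat) (M : 'M[R]_n) (F : 'M[R]_(n, m)) j :
  (F^T *m M *m F) j j = ((col j F)^T *m M *m col j F) 0 0.
Proof.
rewrite !mxE; apply: eq_bigr => k _; rewrite !mxE; congr (_ * _).
by apply: eq_bigr => l _; rewrite !mxE.
Qed.

Lemma mx_posdef_psd (n : nat) (M : 'M[R]_n) : mx_posdef M -> mx_psd M.
Proof.
move=> [sM pM]; split=> // x; have [->|/pM/ltW//] := eqVneq x 0.
by rewrite mulmx0 mxE.
Qed.

Lemma mx_psd_conj (n m : nat) (M : 'M[R]_n) (C : 'M[R]_(n, m)) :
  mx_psd M -> mx_psd (C^T *m M *m C).
Proof.
move=> [sM pM]; split; first by rewrite /mx_symmetric !trmx_mul trmxK sM mulmxA.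
by move=> x; have := pM (C *m x); rewrite trmx_mul !mulmxA.
Qed.

Lemma mx_posdef_unit (n : nat) (M : 'M[R]_n) : mx_posdef M -> M \in unitmx.
Proof.
move=> [sM pM]; rewrite -row_free_unit -kermx_eq0; apply/eqP/row_matrixP => i.
rewrite row0; apply: contraTeq isT => k0.
have kM : row i (kermx M) *m M = 0 by apply/sub_kermxP; exact: row_sub.
have := pM (row i (kermx M))^T; rewrite trmxK kM mul0mx mxE ltxx; apply.
by apply: contra k0 => /eqP/(congr1 trmx); rewrite trmxK linear0 => ->.
Qed.

Lemma mx_posdef_inv (n : nat) (M : 'M[R]_n) : mx_posdef M -> mx_posdef (invmx M).
Proof.
move=> pdM; have uM := mx_posdef_unit pdM; have [sM pM] := pdM.
split; first by rewrite /mx_symmetric trmx_inv sM.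
move=> x x0; have := pM (invmx M *m x).
rewrite trmx_mul trmx_inv sM !mulmxA mulmxKV//; apply.
by apply: contra x0 => /eqP /(congr1 (mulmx M)); rewrite mulKVmx// mulmx0 => ->.
Qed.

Lemma mx_posdef_quad_eq0 (n m : nat) (M : 'M[R]_n) (C : 'M[R]_(n, m)) :
  mx_posdef M -> \tr (C^T *m M *m C) = 0 -> C = 0.
Proof.
move=> pdM /eqP; rewrite psumr_eq0 => [/allP C0|j _]; last first.
  by rewrite diag_quad_form; apply: (mx_posdef_psd pdM).2.
apply/matrixP => i j; rewrite mxE; apply: contraTeq isT => Cij.
have := C0 j (mem_index_enum _); rewrite /= diag_quad_form => /eqP Cj.
suff /pdM.2 : col j C != 0 by rewrite Cj ltxx.
by apply: contra Cij => /eqP/matrixP/(_ i 0); rewrite !mxE => ->.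
Qed.

Lemma mx_psd_trace_ge0 (n : nat) (M : 'M[R]_n) : mx_psd M -> 0 <= \tr M.
Proof.
move=> pM; rewrite -[M]mulmx1 -[M]mul1mx -[X in X *m M]trmx1.
by apply: sumr_ge0 => i _; rewrite diag_quad_form; apply: pM.2.
Qed.

(* Gaussian elimination: peel off the rank-one part carried by the first
   column; the Schur complement is again positive semidefinite. *)
Lemma mx_psd_factor (n : nat) (M : 'M[R]_n) :
  mx_psd M -> exists k, exists F : 'M[R]_(n, k), M = F *m F^T.
Proof.
elim: n M => [|n IHn] M [sM pM].
  by exists 0%N, 0; apply/matrixP => -[].
have [a [m [C ME]]] : exists a : R, exists m : 'cV[R]_n, exists C : 'M[R]_n,
    (M : 'M[R]_(1 + n)) = block_mx a%:M m^T m C.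
  exists (M 0 0), (@dlsubmx _ 1 n 1 n M), (@drsubmx _ 1 n 1 n M).
  rewrite -[LHS](@submxK _ 1 n 1 n); congr block_mx.
    apply/matrixP => i j; rewrite !ord1 !mxE eqxx mulr1n.
    by congr (M _ _); apply: val_inj.
  by rewrite -[LHS]trmxK trmx_ursub; congr (_^T); congr dlsubmx; exact: sM.
have sC : C^T = C.
  have : (block_mx a%:M m^T m C : 'M[R]_(1 + n))^T = block_mx a%:M m^T m C by rewrite -ME.
  by rewrite tr_block_mx => /eq_block_mx[].
have quadM (s : R) (y : 'cV[R]_n) :
    0 <= a * s ^+ 2 + 2 * s * (m^T *m y) 0 0 + (y^T *m C *m y) 0 0.
  have : 0 <= ((col_mx s%:M y)^T *m (M : 'M[R]_(1 + n)) *m col_mx s%:M y) 0 0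
    by exact: pM.
  rewrite ME tr_col_mx mul_row_block mul_row_col tr_scalar_mx !mul_scalar_mx.
  rewrite mul_mx_scalar !mulmxDl !mxE.
  rewrite -?scalemxAl ?mxE ?big_ord1 ?mxE.
  have -> : \sum_j y^T 0 j * m j 0 = \sum_j m^T 0 j * y j 0.
    by apply: eq_bigr => j _; rewrite !mxE mulrC.
  have -> : \sum_j (s *: m^T) 0 j * y j 0 = s * \sum_j m^T 0 j * y j 0.
    by rewrite mulr_sumr; apply: eq_bigr => j _; rewrite !mxE mulrA.
  rewrite mulr1n => H; apply: le_trans H _.
  by rewrite le_eqVlt; apply/orP; left; apply/eqP; ring.
rewrite ME.
change (exists k, exists F : 'M[R]_(1 + n, k), block_mx a%:M m^T m C = F *m F^T).
have a0 : 0 <= a.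
  by have := quadM 1 0; rewrite !mulmx0 !mxE expr1n mulr1 mulr0 !addr0.
have [a_eq0|a_neq0] := eqVneq a 0.
  have m0 : m = 0.
    apply/colP => i; rewrite [RHS]mxE.
    have my (y : 'cV[R]_n) : (m^T *m y) 0 0 = 0.
      apply/eqP/negPn/negP => c0.
      set c := (m^T *m y) 0 0 in c0; set q := (y^T *m C *m y) 0 0.
      (* With [a = 0] the form is affine in [s] with slope [2 * c]; this [s] gives it the value
         -1. *)
      have := quadM (- (q + 1) / (2 * c)) y; rewrite -/c -/q a_eq0 mul0r add0r.
      have -> : 2 * (- (q + 1) / (2 * c)) * c + q = -1 by field.
      by rewrite oppr_ge0 ler10.
    by have := my (delta_mx i 0); rewrite -colE !mxE.
  have [k [F CF]] : exists k, exists F : 'M[R]_(n, k), C = F *m F^T.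
    apply: IHn; split=> // y; have := quadM 0 y.
    by rewrite expr0n !(mulr0, mul0r, add0r).
  exists k, (col_mx 0 F); rewrite a_eq0 m0 CF tr_col_mx mul_col_row.
  by rewrite !trmx0 raddf0 !(mul0mx, mulmx0).
have apos : 0 < a by rewrite lt_neqAle eq_sym a_neq0.
have [k [F CF]] : exists k, exists F : 'M[R]_(n, k),
    C - a^-1 *: (m *m m^T) = F *m F^T.
  apply: IHn; split=> [|y].
    by rewrite /mx_symmetric linearB linearZ /= trmx_mul trmxK sC.
  (* This [s] minimises the form for fixed [y]; the minimum is the quadratic form of the Schur
     complement. *)
  have := quadM (- (m^T *m y) 0 0 / a) y; set c := (m^T *m y) 0 0.
  have entryE (X Y : 'M[R]_1) (u : R) : (X - u *: Y) 0 0 = X 0 0 - u * Y 0 0.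
    by rewrite !mxE.
  have -> : y^T *m (C - a^-1 *: (m *m m^T)) *m y =
      y^T *m C *m y - a^-1 *: ((m^T *m y)^T *m (m^T *m y)).
    rewrite mulmxBr mulmxBl -scalemxAr -scalemxAl trmx_mul trmxK.
    by rewrite !mulmxA.
  rewrite entryE; have -> : ((m^T *m y)^T *m (m^T *m y)) 0 0 = c * c.
    by rewrite mxE big_ord1 mxE.
  have -> : a * (- c / a) ^+ 2 + 2 * (- c / a) * c = - (a^-1 * (c * c)) by field.
  by rewrite addrC.
exists (1 + k)%N,
  (row_mx (col_mx (Num.sqrt a)%:M ((Num.sqrt a)^-1 *: m)) (col_mx 0 F)).
rewrite tr_row_mx mul_row_col !tr_col_mx !mul_col_row.
rewrite !trmx0 !(mul0mx, mulmx0) -CF add_block_mx !addr0.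
have sa : Num.sqrt a != 0 by rewrite sqrtr_eq0 -ltNge.
congr block_mx.
- by rewrite tr_scalar_mx -scalar_mxM -expr2 sqr_sqrtr.
- by rewrite linearZ /= -scalemxAr mul_scalar_mx scalerA mulVf// scale1r.
- by rewrite tr_scalar_mx mul_mx_scalar scalerA mulfV// scale1r.
- rewrite linearZ /= -scalemxAl -scalemxAr scalerA -invfM -expr2 sqr_sqrtr//.
  by rewrite addrC subrK.
Qed.

(** [M *m S] need not be symmetric. With [M = F F^T], moving one factor around the trace leaves
    [F^T S F], which is positive semidefinite. *)
Lemma mx_psd_trace_mul_ge0 (n : nat) (M S : 'M[R]_n) :
  mx_psd M -> mx_psd S -> 0 <= \tr (M *m S).
Proof.
move=> /mx_psd_factor[k [F ->]] pS.
by rewrite -mulmxA mxtrace_mulC; apply/mx_psd_trace_ge0/mx_psd_conj.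
Qed.

Lemma mx_psd_posdef_trace_eq0 (n : nat) (M S : 'M[R]_n) :
  mx_psd M -> mx_posdef S -> \tr (M *m S) = 0 -> M = 0.
Proof.
move=> /mx_psd_factor[k [F ->]] pS.
by rewrite -mulmxA mxtrace_mulC => /(mx_posdef_quad_eq0 pS) ->; rewrite mul0mx.
Qed.

End PositiveMatrices.

Section MatrixNormBounds.
Variable R : realType.

Lemma mx_normr_entry (m n : nat) (M : 'M[R]_(m, n)) i j : `|M i j| <= `|M|.
Proof.
rewrite [leRHS]/Num.Def.normr/= mx_normrE.
exact: (le_bigmax _ (fun ij : 'I_m * 'I_n => `|M ij.1 ij.2|) (i, j)).
Qed.

Lemma mx_normr_le (m n : nat) (M : 'M[R]_(m, n)) (c : R) :
  0 <= c -> (forall i j, `|M i j| <= c) -> `|M| <= c.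
Proof.
move=> c0 Mc; rewrite [leLHS]/Num.Def.normr/= mx_normrE.
by rewrite (bigmax_le _ c0)// => ij _.
Qed.

Lemma mx_normrM (m n p : nat) (M : 'M[R]_(m, n)) (N : 'M[R]_(n, p)) :
  `|M *m N| <= n%:R * `|M| * `|N|.
Proof.
apply: mx_normr_le => [|i j]; first by rewrite !mulr_ge0.
rewrite mxE (le_trans (ler_norm_sum _ _ _))//.
apply: (@le_trans _ _ (\sum_(k < n) `|M| * `|N|)).
  by apply: ler_sum => k _; rewrite normrM ler_pM// mx_normr_entry.
by rewrite sumr_const card_ord -mulrA mulr_natl.
Qed.

Lemma mx_normr_trmx (m n : nat) (M : 'M[R]_(m, n)) : `|M^T| = `|M|.
Proof.
have le_trmx p q (N : 'M[R]_(p, q)) : `|N^T| <= `|N|.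
  by apply: mx_normr_le => // i j; rewrite mxE mx_normr_entry.
by apply/le_anti/andP; split; last rewrite -{1}[M]trmxK.
Qed.

Lemma normr_mxtrace (n : nat) (M : 'M[R]_n) : `|\tr M| <= n%:R * `|M|.
Proof.
rewrite (le_trans (ler_norm_sum _ _ _))//.
apply: (@le_trans _ _ (\sum_(k < n) `|M|)).
  by apply: ler_sum => k _; exact: mx_normr_entry.
by rewrite sumr_const card_ord mulr_natl.
Qed.

End MatrixNormBounds.

(** * Real functions, linear differential equations, compact balls *)

Section RealTools.
Variable R : realType.
Implicit Types (a b t : R) (f df : R -> R).

Lemma derive_le0_nincr f df a b : a <= b ->
  {within `[a, b], continuous f} ->
  (forall t, a < t < b -> is_derive t 1 f (df t)) ->
  (forall t, a < t < b -> df t <= 0) -> f b <= f a.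
Proof.
move=> ab fc Df df0; have [->//|nab] := eqVneq a b.
have {}ab : a < b by rewrite lt_neqAle nab.
have Df' x : x \in `]a, b[ -> is_derive x 1 f (df x) by rewrite in_itv /= => /Df.
have [c cab E] := MVT ab Df' fc.
rewrite in_itv /= in cab; rewrite -subr_le0 E pmulr_lle0 ?subr_gt0//; exact: df0.
Qed.

Lemma derive_gt0_incr f df a b : a < b ->
  {within `[a, b], continuous f} ->
  (forall t, a < t < b -> is_derive t 1 f (df t)) ->
  (forall t, a < t < b -> 0 < df t) -> f a < f b.
Proof.
move=> ab fc Df df0.
have Df' x : x \in `]a, b[ -> is_derive x 1 f (df x) by rewrite in_itv /= => /Df.
have [c cab E] := MVT ab Df' fc.
rewrite in_itv /= in cab; rewrite -subr_gt0 E mulr_gt0 ?subr_gt0//; exact: df0.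
Qed.

Lemma derive_bounded_lipschitz f df a b (L : R) : a <= b ->
  {within `[a, b], continuous f} ->
  (forall t, a < t < b -> is_derive t 1 f (df t)) ->
  (forall t, a < t < b -> `|df t| <= L) -> `|f b - f a| <= L * (b - a).
Proof.
move=> ab fc Df dfL; have [->|nab] := eqVneq a b; first by rewrite !subrr normr0 mulr0.
have {}ab : a < b by rewrite lt_neqAle nab.
have Df' x : x \in `]a, b[ -> is_derive x 1 f (df x) by rewrite in_itv /= => /Df.
have [c cab ->] := MVT ab Df' fc.
have ba : 0 <= b - a by rewrite subr_ge0 ltW.
rewrite in_itv /= in cab; rewrite normrM (ger0_norm ba).
by apply: ler_wpM2r => //; exact: dfL.
Qed.

Lemma derive_pos_near f t (v : R) : is_derive t 1 f v -> 0 < v ->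
  exists2 d : R, 0 < d & forall s, t < s < t + d -> f t < f s.
Proof.
move=> /is_deriveP Df v_gt0.
have : \forall h \near (0:R)^', 0 < h^-1 *: (f (h + t) - f t).
  exact: (cvgr_gt _ Df).
rewrite near_withinE => -[d /= d0 H]; exists d => // s /andP[ts sd].
have := H (s - t); rewrite /= sub0r normrN subrK gtr0_norm ?subr_gt0//.
have -> : s - t < d by lra.
rewrite subr_eq0 => /(_ isT (negbT (gt_eqF ts))).
by rewrite [_ *: _]/(_ * _) pmulr_rgt0 ?invr_gt0 subr_gt0.
Qed.

Lemma derive_neg_near f t (v : R) : is_derive t 1 f v -> v < 0 ->
  exists2 d : R, 0 < d & forall s, t - d < s < t -> f t < f s.
Proof.
move=> /is_deriveP Df v_lt0.
have : \forall h \near (0:R)^', h^-1 *: (f (h + t) - f t) < 0.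
  exact: (cvgr_lt _ Df).
rewrite near_withinE => -[d /= d0 H]; exists d => // s /andP[sd ts].
have := H (s - t); rewrite /= sub0r normrN subrK ltr0_norm ?subr_lt0//.
have -> : - (s - t) < d by lra.
rewrite subr_eq0 => /(_ isT (negbT (lt_eqF ts))).
by rewrite [_ *: _]/(_ * _) nmulr_rlt0 ?invr_lt0 ?subr_lt0// subr_gt0.
Qed.

(** Integrating factor: [expR (C * t) * f t] is nondecreasing and vanishes at [b]. *)
Lemma gronwall_backward f df a b (C : R) : a <= b ->
  {within `[a, b], continuous f} ->
  (forall t, a < t < b -> is_derive t 1 f (df t)) ->
  (forall t, a < t < b -> - (C * f t) <= df t) -> f b = 0 -> f a <= 0.
Proof.
move=> ab fc Df dfC fb0.
have Dexp t : is_derive t 1 (fun x => expR (C * x)) (C * expR (C * t)).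
  have Dl : is_derive t 1 (fun x => C * x) C by apply: is_derive_eq; rewrite [LHS]mulr1.
  apply: is_derive_eq (@is_derive1_comp _ expR (fun x => C * x) t _ _ _ Dl) _.
  exact: mulrC.
have : - (expR (C * b) * f b) <= - (expR (C * a) * f a).
  apply: (@derive_le0_nincr (fun t => - (expR (C * t) * f t))
    (fun t => - (C * expR (C * t) * f t + expR (C * t) * df t)) a b ab).
  - move=> x; apply: cvgN; apply: cvgM; last exact: fc.
    apply: continuous_subspaceT => y; exact: (is_derive_continuous (Dexp y)).
  - move=> t tab; by have := Df _ tab; have := Dexp t => D1 D2; apply: is_derive_eq.
  - move=> t tab; rewrite oppr_le0 [C * _]mulrC -mulrA -mulrDr mulr_ge0 ?expR_ge0//.
    by have := dfC _ tab; rewrite -subr_ge0 opprK addrC.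
by rewrite fb0 mulr0 oppr0 oppr_ge0 pmulr_rle0 ?expR_gt0.
Qed.

Lemma antiderivative f a b : a < b -> {within `[a, b], continuous f} ->
  let F t := \int[lebesgue_measure]_(u in `[a, t]) f u in
  [/\ F a = 0, {within `[a, b], continuous F} &
      forall t, a < t < b -> is_derive t 1 F (f t)].
Proof.
move=> ab fc F; have intf : lebesgue_measure.-integrable `[a, b] (EFin \o f).
  by apply: continuous_compact_integrable => //; exact: segment_compact.
split.
- by rewrite /F set_itv1 Rintegral_set1.
- exact: parameterized_integral_continuous (ltW ab) intf.
- move=> t /andP[at_ tb].
  have ft : {for t, continuous f}.
    by apply: (within_continuous_continuous ab fc); rewrite in_itv/= at_ tb.
  have [DF F'] := continuous_FTC1_closed tb intf at_ ft.
  by apply: (DeriveDef DF); rewrite -derive1E; exact: F'.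
Qed.

End RealTools.

(** * The matrix exponential *)

Section MatrixODE.
Variable R : realType.

(** Taylor coefficients at 0 of the [(i, j)] entry of [exp(x M) Z]. *)
Let coef (n p : nat) (M : 'M[R]_n) (Z : 'M[R]_(n, p)) i j (k : nat) : R :=
  iter k (mulmx M) Z i j * k`!%:R^-1.

Let is_cvg_coef n p (M : 'M[R]_n) (Z : 'M[R]_(n, p)) i j (x : R) :
  cvgn (pseries (coef M Z i j) x).
Proof.
apply: normed_cvg; set q := n%:R * `|M|.
have q0 : 0 <= q by rewrite mulr_ge0.
have iterM k : `|iter k (mulmx M) Z| <= q ^+ k * `|Z|.
  elim: k => [|k IHk]; first by rewrite expr0 mul1r.
  by rewrite iterS (le_trans (mx_normrM _ _))// exprS -!mulrA ler_wpM2l// ler_wpM2l.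
apply: (@series_le_cvg _ _ (`|Z| *: exp_coeff (q * `|x|))) => [k|k|k|].
- exact: normr_ge0.
- by rewrite /= mulr_ge0// exp_coeff_ge0// mulr_ge0.
- rewrite [leRHS](_ : _ = `|Z| * ((q * `|x|) ^+ k / k`!%:R))//.
  rewrite /= /coef !normrM normrX exprMn.
  rewrite [`|_^-1|]ger0_norm ?invr_ge0//.
  have -> : `|Z| * (q ^+ k * `|x| ^+ k / k`!%:R) =
    q ^+ k * `|Z| / k`!%:R * `|x| ^+ k by ring.
  rewrite ler_wpM2r ?exprn_ge0// ler_wpM2r ?invr_ge0//.
  by rewrite (le_trans _ (iterM k))// mx_normr_entry.
- apply: is_cvg_seriesZ; exact: is_cvg_series_exp_coeff.
Qed.

(** The entries of [exp(t M) Z0] are power series. Termwise differentiation turns the coefficients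
    for [N] into those for [M *m N], since [(k+1) / (k+1)! = 1 / k!]. *)
Lemma linear_ode (n p : nat) (M : 'M[R]_n) (Z0 : 'M[R]_(n, p)) :
  exists Z : R -> 'M[R]_(n, p),
    Z 0 = Z0 /\ forall t : R, is_derive t 1 Z (M *m Z t).
Proof.
pose Z (N : 'M[R]_(n, p)) (t : R) : 'M[R]_(n, p) :=
  \matrix_(i, j) limn (pseries (coef M N i j) t).
have diffs N i j : pseries_diffs (coef M N i j) = coef M (M *m N) i j.
  apply/funext => k; rewrite /pseries_diffs /coef iterSr factS natrM invfM.
  by rewrite mulrCA mulVKf.
exists (Z Z0); split.
  apply/matrixP => i j; rewrite mxE; apply: lim_near_cst => //.
  near=> m; rewrite -[m]prednK; last by near: m.
  rewrite /pseries /series /= big_nat_recl// big1 ?addr0 => [|k _].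
    by rewrite expr0 mulr1 /coef fact0 invr1 mulr1.
  by rewrite expr0n mulr0.
move=> t; have -> : M *m Z Z0 t = Z (M *m Z0) t.
  apply/matrixP => i j; rewrite !mxE; under eq_bigr do rewrite mxE.
  apply/esym/cvg_lim => //.
  have -> : pseries (coef M (M *m Z0) i j) t =
     (fun N => \sum_l M i l * pseries (coef M Z0 l j) t N).
    apply/funext => N; under eq_bigr do rewrite /pseries /series /= mulr_sumr.
    rewrite exchange_big/=; apply: eq_bigr => k _.
    rewrite /= /coef -(iterSr k (mulmx M) Z0) iterS mxE !mulr_suml; apply: eq_bigr => l _.
    by rewrite !mulrA.
  apply: cvg_bigsum => l; apply: cvgM; first exact: cvg_cst.
  exact: is_cvg_coef.
apply/is_derive_mxP => i j; rewrite mxE.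
under eq_fun do rewrite mxE.
rewrite -diffs; apply: (@pseries_snd_diffs _ _ (`|t| + 1)).
- exact: is_cvg_coef.
- by rewrite diffs; exact: is_cvg_coef.
- by rewrite !diffs; exact: is_cvg_coef.
- by rewrite [ltRHS]ger0_norm ?ltrDl// addr_ge0.
Unshelve. all: by end_near. Qed.

End MatrixODE.

(** * Compactness in matrix spaces *)

Section CompactBalls.
Variable R : realType.

(** [vec_mx] is an isometry for the max norms, so the ball is a translate of the image of a closed
    bounded set of row vectors. *)
Lemma mx_ball_compact (m n : nat) (M : 'M[R]_(m, n)) (e : R) :
  compact [set N : 'M[R]_(m, n) | `|N - M| <= e].
Proof.
have cv (v : 'rV[R]_(m * n)) :
    vec_mx w + M @[w --> nbhs v] --> (vec_mx v + M : 'M[R]_(m, n)).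
  apply: cvgD; last exact: cvg_cst.
  apply/mx_cvgP => i j; under eq_fun do rewrite mxE; rewrite mxE.
  exact: coord_continuous.
have nv (v : 'rV[R]_(m * n)) : `|vec_mx v| = `|v|.
  apply/le_anti/andP; split; apply: mx_normr_le => // i j.
    by rewrite mxE mx_normr_entry.
  rewrite ord1 -{1}[v]vec_mxK; case/mxvec_indexP: j => k l.
  by rewrite mxvecE mx_normr_entry.
have -> : [set N : 'M[R]_(m, n) | `|N - M| <= e] =
    (fun v : 'rV[R]_(m * n) => vec_mx v + M) @` [set v | `|v| <= e].
  apply/seteqP; split=> [N /= Ne|_ [v /= ve <-]] /=; last by rewrite addrK nv.
  exists (mxvec (N - M)); last by rewrite mxvecK subrK.
  by rewrite -nv mxvecK.
apply: continuous_compact; first exact: continuous_subspaceT.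
apply: bounded_closed_compact.
  exists e; split; first exact: num_real.
  by move=> x ex v /= ve; rewrite (le_trans ve)// ltW.
apply: (@preimage_closed _ _ (fun v : 'rV[R]_(m * n) => `|v|) [set x : R | x <= e]);
  last exact: closed_le.
by move=> v _; exact: norm_continuous.
Qed.

Lemma within_continuous_bounded (V : normedModType R) (f : R -> V) (a b : R) :
  {within `[a, b], continuous f} ->
  exists2 c : R, 0 < c & forall t, a <= t <= b -> `|f t| <= c.
Proof.
move=> fc; have [c [_ fb]] :=
  compact_bounded (continuous_compact fc (@segment_compact _ a b)).
exists (`|c| + 1); first by rewrite ltr_wpDl.
move=> t tab; apply: (fb (`|c| + 1)); first by rewrite ltr_pwDr// ler_norm.
by exists t; rewrite //= in_itv.
Qed.

Lemma compact_continuous_pos (T : topologicalType) (K : set T) (f : T -> R) :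
  compact K -> {within K, continuous f} -> (forall x, K x -> 0 < f x) ->
  exists2 c : R, 0 < c & forall x, K x -> c <= f x.
Proof.
move=> cK fc f0; have [[x0 Kx0]|K0] := pselect (K !=set0); last first.
  by exists 1 => // x Kx; exfalso; apply: K0; exists x.
have [|c cK' cmin] := compact_EVT_min _ cK fc; first by exists x0.
exists (f c); first by apply: f0; rewrite inE in cK'.
by move=> x Kx; apply: cmin; rewrite inE.
Qed.

End CompactBalls.

(** * The Riccati flow *)

Section LinearUniqueness.
Variable R : realType.

(** Compares the max norm with the squared Frobenius norm, which can be differentiated along a
    trajectory. *)
Lemma mx_normr_sqr_le (m n : nat) (Z : 'M[R]_(m, n)) : `|Z| ^+ 2 <= \tr (Z^T *m Z).
Proof.
have trE : \tr (Z^T *m Z) = \sum_j \sum_i Z i j ^+ 2.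
  by apply: eq_bigr => j _; rewrite mxE; apply: eq_bigr => i _; rewrite mxE.
have tr0 : 0 <= \tr (Z^T *m Z).
  by rewrite trE !sumr_ge0// => j _; rewrite sumr_ge0// => i _; rewrite sqr_ge0.
suff : `|Z| <= Num.sqrt (\tr (Z^T *m Z)).
  by move=> H; rewrite -(sqr_sqrtr tr0) lerXn2r// nnegrE ?sqrtr_ge0.
apply: mx_normr_le; first exact: sqrtr_ge0.
move=> i j; rewrite -sqrtr_sqr ler_wsqrtr// trE.
rewrite (bigD1 j)//= (bigD1 i)//= -addrA lerDl addr_ge0//.
  by rewrite sumr_ge0// => k _; rewrite sqr_ge0.
by rewrite sumr_ge0// => k _; rewrite sumr_ge0// => l _; rewrite sqr_ge0.
Qed.

(** Backward Gronwall applied to the squared Frobenius norm of [Z], whose derivative is at most [C]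
    times itself in absolute value. *)
Lemma linear_ode_backward (k p : nat) (a b : R) (M : R -> 'M[R]_k)
    (Z : R -> 'M[R]_(k, p)) : a <= b ->
  {within `[a, b], continuous M} -> {within `[a, b], continuous Z} ->
  (forall t, a < t < b -> is_derive t 1 Z (M t *m Z t)) -> Z b = 0 -> Z a = 0.
Proof.
move=> ab Mc Zc DZ Zb; have [c c0 Mb] := within_continuous_bounded Mc.
pose f t := \tr ((Z t)^T *m Z t).
suff fa : f a <= 0.
  apply/eqP; rewrite -normr_eq0 -sqrf_eq0 eq_le sqr_ge0 andbT.
  by rewrite (le_trans (mx_normr_sqr_le _)).
(* The 2 counts the two transposed terms of the derivative, [p] comes from bounding the trace, each
   [k] from one matrix product, [c] from [M]. *)
pose C := 2 * (p%:R * k%:R * k%:R * c).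
have C0 : 0 <= C by rewrite !mulr_ge0// ltW.
apply: (@gronwall_backward _ f
  (fun t => \tr ((M t *m Z t)^T *m Z t + (Z t)^T *m (M t *m Z t))) a b C) => //.
- by move=> t; apply: cvg_mxtrace; apply: cvg_mulmx; [apply: cvg_trmx|]; exact: Zc.
- by move=> t tab; have := DZ t tab => D; apply: is_derive_eq.
- move=> t /andP[at_ tb].
  have -> : \tr ((M t *m Z t)^T *m Z t + (Z t)^T *m (M t *m Z t)) =
     2 * \tr ((Z t)^T *m (M t *m Z t)).
    rewrite linearD /= -mxtrace_tr trmx_mul trmxK; ring.
  have : `|\tr ((Z t)^T *m (M t *m Z t))| <= p%:R * k%:R * k%:R * c * f t.
    rewrite (le_trans (normr_mxtrace _))// -!mulrA ler_wpM2l//.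
    rewrite (le_trans (mx_normrM _ _))// -!mulrA ler_wpM2l// mx_normr_trmx.
    rewrite (@le_trans _ _ (`|Z t| * (k%:R * `|M t| * `|Z t|)))//.
      by rewrite ler_wpM2l// mx_normrM.
    have -> : `|Z t| * (k%:R * `|M t| * `|Z t|) = k%:R * (`|M t| * `|Z t| ^+ 2) by ring.
    rewrite ler_wpM2l// ler_pM// ?sqr_ge0//; last exact: mx_normr_sqr_le.
    by apply: Mb; rewrite !ltW.
  by rewrite ler_norml => /andP[H _]; rewrite /C; lra.
- by rewrite /f Zb trmx0 mul0mx mxtrace0.
Qed.

End LinearUniqueness.

Section RiccatiFlow.
Variables (R : realType) (n : nat) (A G Q : 'M[R]_n).

(** The Hamiltonian matrix of the linear-quadratic problem, with the sign that makes the flow run in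
    time-to-go: [X' = - A X + G Y], [Y' = Q X + A^T Y]. *)
Let hamiltonian_matrix : 'M[R]_(n + n) := block_mx (- A) G Q A^T.

Let flow : R -> 'M[R]_(n + n) := sval (cid (linear_ode hamiltonian_matrix 1%:M)).

Let flow0 : flow 0 = 1%:M.
Proof. exact: (svalP (cid (linear_ode hamiltonian_matrix 1%:M))).1. Qed.

Let derive_flow (t : R) : is_derive t 1 flow (hamiltonian_matrix *m flow t).
Proof. exact: (svalP (cid (linear_ode hamiltonian_matrix 1%:M))).2. Qed.

Definition ham_state (tau : R) (P : 'M[R]_n) : 'M[R]_n :=
  usubmx (flow tau *m col_mx 1%:M P).
Definition ham_costate (tau : R) (P : 'M[R]_n) : 'M[R]_n :=
  dsubmx (flow tau *m col_mx 1%:M P).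
(* [riccati tau P] is the Riccati solution at time-to-go [tau] from the
   terminal value [P], obtained from the linear Hamiltonian flow as the
   quotient [Y X^-1]; it is meaningful only as long as [X] stays invertible. *)
Definition riccati (tau : R) (P : 'M[R]_n) : 'M[R]_n :=
  ham_costate tau P *m invmx (ham_state tau P).
(** Invertibility is required at every intermediate time, because the quotient [Y X^-1] may blow up
    wherever [X] becomes singular. *)
Definition no_escape (s : R) (P : 'M[R]_n) : Prop :=
  forall tau, 0 <= tau <= s -> ham_state tau P \in unitmx.
Definition riccati_field (P : 'M[R]_n) : 'M[R]_n :=
  Q + A^T *m P + P *m A - P *m G *m P.

Local Notation X := ham_state.
Local Notation Y := ham_costate.

Lemma ham_state0 P : X 0 P = 1%:M.
Proof. by rewrite /X flow0 mul1mx col_mxKu. Qed.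

Lemma ham_costate0 P : Y 0 P = P.
Proof. by rewrite /Y flow0 mul1mx col_mxKd. Qed.

Lemma riccati0 P : riccati 0 P = P.
Proof. by rewrite /riccati ham_state0 ham_costate0 invmx1 mulmx1. Qed.

Let derive_ham (t : R) P :
  is_derive t 1 (fun tau => flow tau *m col_mx 1%:M P)
    (col_mx (- A *m X t P + G *m Y t P) (Q *m X t P + A^T *m Y t P)).
Proof.
have D := derive_flow t; apply: is_derive_eq.
rewrite mulmx0 addr0 -mulmxA -[in LHS](vsubmxK (flow t *m _)).
by rewrite /hamiltonian_matrix mul_block_col.
Qed.

Global Instance is_derive_ham_state (t : R) P :
  is_derive t 1 (X ^~ P) (- A *m X t P + G *m Y t P).
Proof.
apply/is_derive_mxP => i j; under eq_fun do rewrite mxE.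
have /is_derive_mxP/(_ (lshift n i) j) := derive_ham t P.
by rewrite col_mxEu.
Qed.

Global Instance is_derive_ham_costate (t : R) P :
  is_derive t 1 (Y ^~ P) (Q *m X t P + A^T *m Y t P).
Proof.
apply/is_derive_mxP => i j; under eq_fun do rewrite mxE.
have /is_derive_mxP/(_ (rshift n i) j) := derive_ham t P.
by rewrite col_mxEd.
Qed.

Lemma ham_state_continuous P : continuous (X ^~ P).
Proof. by move=> t; exact: is_derive_continuous. Qed.

Lemma ham_costate_continuous P : continuous (Y ^~ P).
Proof. by move=> t; exact: is_derive_continuous. Qed.

(** [F] is the upper right block of the flow: the initial value [col_mx 1%:M P] is affine in [P],
    and the flow is linear. *)
Lemma ham_state_affine : exists2 F : R -> 'M[R]_n, continuous F &
  forall tau P1 P2, X tau P2 = X tau P1 + F tau *m (P2 - P1).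
Proof.
exists (fun tau => usubmx (flow tau *m col_mx 0 1%:M)) => [t|tau P1 P2].
  have D := derive_flow t.
  have : flow tau *m col_mx 0 1%:M @[tau --> t] --> flow t *m col_mx 0 (1%:M : 'M[R]_n).
    exact: is_derive_continuous.
  move=> /mx_cvgP F; apply/mx_cvgP => i j; rewrite mxE; under eq_fun do rewrite mxE.
  exact: F.
rewrite /X mul_usub_mx -linearD /= -mulmxA -mulmxDr mul_col_mx mul0mx mul1mx.
by rewrite add_col_mx addr0 subrKC.
Qed.

Lemma riccati_cvg (T : Type) (F : set_system T) {FF : Filter F} (f : T -> R) t P :
  f x @[x --> F] --> t -> X t P \in unitmx ->
  riccati (f x) P @[x --> F] --> riccati t P.
Proof.
move=> ft Xt; apply: cvg_mulmx.
  exact: (cvg_comp _ _ ft (@ham_costate_continuous P t)).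
by apply: cvg_invmx => //; exact: (cvg_comp _ _ ft (@ham_state_continuous P t)).
Qed.

Lemma is_derive_riccati (t : R) P : X t P \in unitmx ->
  is_derive t 1 (riccati ^~ P) (riccati_field (riccati t P)).
Proof.
move=> Xt; have D1 := is_derive_invmx (is_derive_ham_state t P) Xt.
have E (U V I : 'M[R]_n) : U *m I = 1%:M ->
    (Q *m U + A^T *m V) *m I + V *m (- (I *m (- A *m U + G *m V) *m I)) =
    riccati_field (V *m I).
  move=> UI; rewrite /riccati_field mulmxN !(mulmxDl, mulmxDr, mulNmx, mulmxN).
  rewrite !mulmxA opprD opprK -![_ *m U *m I]mulmxA UI !mulmx1.
  by rewrite -!addrA.
by apply: is_derive_eq; apply: E; rewrite mulmxV.
Qed.

End RiccatiFlow.

Lemma cvg_col_mx (R : realType) (T : Type) (F : set_system T) {FF : Filter F}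
    (m n k : nat) (f : T -> 'M[R]_(m, k)) (g : T -> 'M[R]_(n, k))
    (M : 'M[R]_(m, k)) (N : 'M[R]_(n, k)) :
  f x @[x --> F] --> M -> g x @[x --> F] --> N ->
  col_mx (f x) (g x) @[x --> F] --> col_mx M N.
Proof.
move=> /mx_cvgP fM /mx_cvgP gN; apply/mx_cvgP => i j; rewrite mxE.
under eq_fun do rewrite mxE.
by case: (fintype.split i) => l; [exact: fM|exact: gN].
Qed.

Lemma is_derive_col_mx (R : realType) (m n k : nat) (f : R -> 'M[R]_(m, k))
    (g : R -> 'M[R]_(n, k)) (t : R) (df : 'M[R]_(m, k)) (dg : 'M[R]_(n, k)) :
  is_derive t 1 f df -> is_derive t 1 g dg ->
  is_derive t 1 (fun x => col_mx (f x) (g x)) (col_mx df dg).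
Proof.
move=> /is_derive_mxP Df /is_derive_mxP Dg; apply/is_derive_mxP => i j.
rewrite mxE; under eq_fun do rewrite mxE.
by case: (fintype.split i) => l; [exact: Df|exact: Dg].
Qed.

Lemma right_injective_unitmx (R : realType) (n : nat) (M : 'M[R]_n) :
  (forall V : 'M[R]_n, M *m V = 0 -> V = 0) -> M \in unitmx.
Proof.
move=> Minj; rewrite -unitmx_tr -row_free_unit -kermx_eq0.
apply/eqP/trmx_inj; rewrite trmx0; apply: Minj.
by rewrite -{1}[M]trmxK -trmx_mul mulmx_ker trmx0.
Qed.

(** * Symplectic structure and perturbation of Riccati solutions *)

Section RiccatiTheory.
Variables (R : realType) (n : nat) (A G Q : 'M[R]_n).
Hypotheses (hG : G^T = G) (hQ : Q^T = Q).

Local Notation X := (ham_state A G Q).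
Local Notation Y := (ham_costate A G Q).
Local Notation p := (riccati A G Q).
Local Notation good := (no_escape A G Q).

(** The symplectic form of two solutions of the Hamiltonian system is conserved, because [G] and [Q]
    are symmetric; its value is read off at time 0. Both the symmetry of Riccati solutions and the
    formula for their difference follow. *)
Lemma wronskian tau P1 P2 :
  (X tau P1)^T *m Y tau P2 - (Y tau P1)^T *m X tau P2 = P2 - P1^T.
Proof.
pose f t := (X t P1)^T *m Y t P2 - (Y t P1)^T *m X t P2.
have E (x1 y1 x2 y2 : 'M[R]_n) :
    (- A *m x1 + G *m y1)^T *m y2 + x1^T *m (Q *m x2 + A^T *m y2) -
    ((Q *m x1 + A^T *m y1)^T *m x2 + y1^T *m (- A *m x2 + G *m y2)) = 0.
  rewrite !linearD /= !trmx_mul linearN /= hG hQ trmxK.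
  rewrite !(mulmxDl, mulmxDr, mulNmx, mulmxN) !mulmxA.
  by apply/matrixP => i j; rewrite !mxE; ring.
have Df (t : R) : is_derive t 1 f 0 by apply: is_derive_eq; exact: E.
have -> : P2 - P1^T = f 0 by rewrite /f !ham_state0 !ham_costate0 trmx1 mul1mx mulmx1.
apply/matrixP => i j; rewrite -/(f tau).
apply: (is_derive_0_is_cst (f := fun t => f t i j)) => t.
by have /is_derive_mxP/(_ i j) := Df t; rewrite mxE.
Qed.

Lemma riccati_sym tau P : P^T = P -> X tau P \in unitmx -> (p tau P)^T = p tau P.
Proof.
move=> sP Xu; have := wronskian tau P P; rewrite sP subrr => /eqP.
rewrite subr_eq0 => /eqP W; rewrite /riccati trmx_mul trmx_inv.
have XTu : (X tau P)^T \in unitmx by rewrite unitmx_tr.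
apply: (can_inj (mulKmx XTu)); apply: (can_inj (mulmxK Xu)).
by rewrite mulKVmx// mulmxA mulmxKV// W.
Qed.

(** The Wronskian identity multiplied by [X1^-T] on the left and [X2^-1] on the right. It reduces
    Lipschitz dependence on [P] to bounds on the two inverses. *)
Lemma riccati_diff tau P1 P2 : P1^T = P1 ->
  X tau P1 \in unitmx -> X tau P2 \in unitmx ->
  p tau P2 - p tau P1 =
  (invmx (X tau P1))^T *m (P2 - P1) *m invmx (X tau P2).
Proof.
move=> sP1 Xu1 Xu2; have := wronskian tau P1 P2; rewrite sP1 => <-.
rewrite mulmxBr mulmxBl !mulmxA trmx_inv mulVmx ?unitmx_tr// mul1mx.
congr (_ - _); rewrite mulmxK// -[LHS]riccati_sym// /riccati trmx_mul.
by rewrite trmx_inv.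
Qed.

(** If both blocks annihilate [v] at [tau], backward uniqueness makes [col_mx v (P *m v)] vanish at
    time 0. *)
Lemma ham_injective tau P (k : nat) (v : 'M[R]_(n, k)) : 0 <= tau ->
  X tau P *m v = 0 -> Y tau P *m v = 0 -> v = 0.
Proof.
move=> tau0 Xv Yv; pose Z t := col_mx (X t P *m v) (Y t P *m v).
have : Z 0 = 0.
  apply: (@linear_ode_backward _ _ _ 0 tau (fun=> block_mx (- A) G Q A^T)) => //.
  - by apply: continuous_subspaceT => t; exact: cst_continuous.
  - apply: continuous_subspaceT => t; apply: cvg_col_mx.
      by apply: cvg_mulmx; [exact: ham_state_continuous|exact: cvg_cst].
    by apply: cvg_mulmx; [exact: ham_costate_continuous|exact: cvg_cst].
  - move=> t _; rewrite mul_block_col; apply: is_derive_col_mx.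
      by apply: is_derive_eq; rewrite mulmx0 addr0 mulmxDl !mulmxA.
    by apply: is_derive_eq; rewrite mulmx0 addr0 mulmxDl !mulmxA.
  - by rewrite /Z Xv Yv col_mx0.
by rewrite /Z ham_state0 mul1mx => /(congr1 usubmx); rewrite col_mxKu linear0.
Qed.

Lemma ham_state_unit tau P (W : 'M[R]_n) : 0 <= tau ->
  Y tau P = W *m X tau P -> X tau P \in unitmx.
Proof.
move=> tau0 YWX; apply: right_injective_unitmx => V XV.
by apply: (ham_injective tau0 XV); rewrite YWX -mulmxA XV mulmx0.
Qed.

(** For a given solution [P], the defect [W = Y - P X] solves a homogeneous linear equation with
    zero terminal value, so [Y = P X] on the whole interval. Then [X v = 0] forces [Y v = 0], hence
    [v = 0]: a solution that exists on [0, s] rules out escape and equals the quotient. *)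
Lemma riccati_unique (s : R) (P : R -> 'M[R]_n) : 0 <= s ->
  {within `[0, s], continuous P} ->
  (forall t, 0 < t < s -> is_derive t 1 P (- riccati_field A G Q (P t))) ->
  good s (P s) /\ forall t, 0 <= t <= s -> P t = p (s - t) (P s).
Proof.
move=> s0 Pc DP.
have YPX t : 0 <= t <= s -> Y (s - t) (P s) = P t *m X (s - t) (P s).
  move=> /andP[t0 ts]; apply/eqP; rewrite -subr_eq0; apply/eqP.
  pose W u := Y (s - u) (P s) - P u *m X (s - u) (P s).
  have sub : `[t, s] `<=` `[0, s] by apply: subset_itvr; rewrite bnd_simp.
  have Pc' : {within `[t, s], continuous P} by exact: continuous_subspaceW Pc.
  have sc (Z : R -> 'M[R]_n) : continuous Z ->
      {within `[t, s], continuous (fun u => Z (s - u))}.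
    move=> Zc; apply: continuous_subspaceT => u.
    apply: (@continuous_comp _ _ _ (fun u => s - u) Z); last exact: Zc.
    by apply: cvgB; [exact: cvg_cst|exact: cvg_id].
  apply: (@linear_ode_backward _ _ _ t s (fun u => - A^T + P u *m G) W) => //.
  - move=> u; apply: cvgD; first exact: cvg_cst.
    by apply: cvg_mulmx; [exact: Pc'|exact: cvg_cst].
  - move=> u; apply: cvgB; first exact: (sc _ (@ham_costate_continuous _ _ A G Q (P s))).
    by apply: cvg_mulmx; [exact: Pc'|exact: (sc _ (@ham_state_continuous _ _ A G Q (P s)))].
  - move=> u /andP[tu us].
    have D1 := is_derive_mx_reflect (is_derive_ham_state A G Q (s - u) (P s)).
    have D2 := is_derive_mx_reflect (is_derive_ham_costate A G Q (s - u) (P s)).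
    have u0s : 0 < u < s by rewrite us (le_lt_trans t0).
    have D3 := DP u u0s.
    apply: is_derive_eq.
    have E (x y w : 'M[R]_n) : - (Q *m x + A^T *m y) -
        (- riccati_field A G Q w *m x + w *m - (- A *m x + G *m y)) =
        (- A^T + w *m G) *m (y - w *m x).
      rewrite /riccati_field !(mulmxDl, mulmxDr, mulNmx, mulmxN) !mulmxA.
      by apply/matrixP => i j; rewrite !mxE; ring.
    exact: E.
  - by rewrite /W subrr ham_costate0 ham_state0 mulmx1 subrr.
split=> [tau /andP[tau0 taus]|t t0s].
  apply: (@ham_state_unit _ _ (P (s - tau))) => //.
  by have := YPX (s - tau); rewrite subKr; apply; lra.
rewrite /riccati YPX// mulmxK//.
by apply: (@ham_state_unit _ _ (P t)); [lra|exact: YPX].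
Qed.

Lemma no_escapeW s s' P : s <= s' -> good s' P -> good s P.
Proof.
by move=> ss' gP tau /andP[tau0 taus]; apply: gP; rewrite tau0 (le_trans taus).
Qed.

Lemma no_escape_extend s P : 0 <= s -> good s P -> exists2 s', s < s' & good s' P.
Proof.
move=> s0 gP; have Xs : X s P \in unitmx by apply: gP; rewrite s0 lexx.
have /nbhs_ballP[d /= d0 H] : \forall tau \near s, X tau P \in unitmx.
  exact: (cvg_near_unitmx (@ham_state_continuous _ _ A G Q P s) Xs).
exists (s + d / 2); first by rewrite ltrDl divr_gt0.
move=> tau /andP[tau0 taus]; have [ts|st] := leP tau s; first by apply: gP; rewrite tau0.
by apply: H; rewrite /ball /= ltr0_norm; lra.
Qed.

(* Writing [X2 = X1 (1 + N)] with [N = O(|P2 - P1|)], a Neumann-type bound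
   keeps [X2] invertible with [X2^-1] bounded, uniformly on [0, s]. *)
Lemma riccati_lipschitz s P1 : 0 <= s -> P1^T = P1 -> good s P1 ->
  exists rho C : R, [/\ 0 < rho, 0 < C &
    forall P2, `|P2 - P1| <= rho -> good s P2 /\
      forall tau, 0 <= tau <= s -> `|p tau P2 - p tau P1| <= C * `|P2 - P1|].
Proof.
move=> s0 sP1 gP1; have [F Fc FE] := ham_state_affine A G Q.
have Ic : {within `[0, s], continuous (fun tau => invmx (X tau P1))}.
  apply: continuous_in_subspaceT => tau; rewrite inE /= in_itv /= => tau0s.
  apply: cvg_invmx; last exact: gP1.
  exact: ham_state_continuous.
have [c c0 Ib] := within_continuous_bounded Ic.
have Fc' : {within `[0, s], continuous F} by exact: continuous_subspaceT.
have [d d0 Fb] := within_continuous_bounded Fc'.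
pose N : R := n%:R; have N0 : 0 <= N by rewrite ler0n.
pose K := N * (N * (N * c * d)).
have K0 : 0 <= K by rewrite !mulr_ge0// ltW.
have K10 : 0 < 2 * (K + 1) by rewrite mulr_gt0// ltr_wpDl.
(* With [X2 = X1 (1 + E)], the map [V |-> E V] has norm at most [K * |P2 - P1|], so this radius
   makes it at most 1/2 and [X2^-1] is bounded by [2 * c]. The added ones keep both constants
   positive when [n] is 0. *)
exists (2 * (K + 1))^-1, (N * (N * c) * (2 * c) + 1); split.
- by rewrite invr_gt0.
- by rewrite ltr_wpDl// !mulr_ge0// ltW.
move=> P2 P2rho; set D := `|P2 - P1| in P2rho *.
have KD : 2 * (K * D) <= 1.
  have := ler_pM2l K10 D (2 * (K + 1))^-1; rewrite divff ?gt_eqF// P2rho.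
  have : 0 <= D by exact: normr_ge0.
  by nra.
have key tau : 0 <= tau <= s ->
    X tau P2 \in unitmx /\ `|invmx (X tau P2)| <= 2 * c.
  move=> tau0s; have Xu1 := gP1 _ tau0s.
  set I := invmx (X tau P1); pose E := I *m F tau *m (P2 - P1).
  have X2E : X tau P2 = X tau P1 *m (1%:M + E).
    by rewrite (FE _ P1) [RHS]mulmxDr mulmx1 /E -mulmxA mulKVmx// mulmxA.
  have NE (V : 'M[R]_n) : 2 * `|E *m V| <= `|V|.
    have E1 : `|E| <= N * (N * c * d) * D.
      rewrite (le_trans (mx_normrM _ _))// ler_wpM2r// ler_wpM2l//.
      rewrite (le_trans (mx_normrM _ _))// ler_pM ?mulr_ge0//; last exact: Fb.
      by rewrite ler_wpM2l//; exact: Ib.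
    have := mx_normrM E V; rewrite -/N => EV.
    have : N * `|E| * `|V| <= K * D * `|V|.
      rewrite ler_wpM2r//.
      have -> : K * D = N * (N * (N * c * d) * D) by rewrite /K; ring.
      by rewrite ler_wpM2l.
    have : 0 <= `|V| by [].
    by nra.
  have Xu2 : X tau P2 \in unitmx.
    rewrite X2E unitmx_mul Xu1; apply: right_injective_unitmx => V EV.
    have VE : V = - (E *m V) by apply/eqP; rewrite -addr_eq0 -[X in X + _]mul1mx -mulmxDl EV.
    have := NE V; rewrite -normrN -VE => H.
    by apply/eqP; rewrite -normr_eq0 eq_le normr_ge0 andbT; lra.
  split=> //; set V := invmx (X tau P2).
  have VE : V = I - E *m V.
    have : (1%:M + E) *m V = I.
      by rewrite -[LHS](mulKmx Xu1) [X in _ *m X]mulmxA -X2E mulmxV// mulmx1.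
    by rewrite mulmxDl mul1mx => <-; rewrite addrK.
  have := NE V; have := Ib _ tau0s; rewrite -/I.
  have : `|V| <= `|I| + `|E *m V| by rewrite {1}VE ler_normB.
  by lra.
split=> [tau /key[]//|tau tau0s]; have [Xu2 Vb] := key tau tau0s.
rewrite riccati_diff//; last exact: gP1.
rewrite mulrDl (@le_trans _ _ (N * (N * c) * (2 * c) * D))//; last first.
  by rewrite lerDl mul1r normr_ge0.
rewrite (le_trans (mx_normrM _ _))//.
rewrite [leRHS](_ : _ = N * (N * c * D) * (2 * c)); last by ring.
rewrite ler_pM ?mulr_ge0// ler_wpM2l//.
rewrite (le_trans (mx_normrM _ _))// ler_wpM2r// ler_wpM2l// mx_normr_trmx.
exact: Ib.
Qed.

End RiccatiTheory.

(** * Duality *)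

Lemma within_continuous_reflect (R : realType) (V : topologicalType)
    (f : R -> V) (a b s : R) : {within `[s - b, s - a], continuous f} ->
  {within `[a, b], continuous (fun t => f (s - t))}.
Proof.
move=> /subspace_continuousP fc; apply/subspace_continuousP => t /=.
rewrite in_itv /= => /andP[at_ tb].
have Ist : `[s - b, s - a]%classic (s - t).
  by rewrite /= in_itv /= !lerD2l !lerN2 tb.
have sc : s - u @[u --> t] --> s - t.
  by apply: cvgB; [exact: cvg_cst|exact: cvg_id].
have scw : s - u @[u --> within `[a, b] (nbhs t)] -->
    within `[s - b, s - a] (nbhs (s - t)).
  move=> B HB; have H := sc _ HB.
  suff : \forall u \near within `[a, b] (nbhs t), B (s - u) by [].
  rewrite near_withinE; near=> u; rewrite /= in_itv /= => /andP[au ub].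
  have H' : `[s - b, s - a]%classic (s - u) -> B (s - u) by near: u; exact: H.
  apply: H'.
  by rewrite /= in_itv /= !lerD2l !lerN2 ub.
exact: (cvg_comp _ _ scw (fc _ Ist)).
Unshelve. all: by end_near. Qed.

Lemma mxtraceN (R : realType) (n : nat) (M : 'M[R]_n) : \tr (- M) = - \tr M.
Proof. exact: linearN. Qed.

Lemma mxtraceB (R : realType) (n : nat) (M N : 'M[R]_n) :
  \tr (M - N) = \tr M - \tr N.
Proof. exact: linearB. Qed.

Section Duality.
Variables (R : realType) (n : nat) (A G Q D : 'M[R]_n) (varpi : R).
Hypotheses (pG : mx_psd G) (pQ : mx_psd Q).

Local Notation p := (riccati A G Q).
Local Notation good := (no_escape A G Q).
Local Notation field := (riccati_field A G Q).

Let hG : G^T = G := pG.1.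
Let hQ : Q^T = Q := pQ.1.

Lemma mxtrace_riccati_field (P S : 'M[R]_n) : P^T = P -> S^T = S ->
  \tr (field P *m S) =
  \tr (Q *m S) + 2 * \tr (P *m A *m S) - \tr (P *m G *m P *m S).
Proof.
move=> sP sS; have e : \tr (A^T *m P *m S) = \tr (P *m A *m S).
  by rewrite -mxtrace_tr !trmx_mul trmxK sS sP mxtrace_mulC.
by rewrite !(mulmxDl, mulNmx) !(mxtraceD, mxtraceN) e; ring.
Qed.

Lemma mxtrace_cov_field (Z P S : 'M[R]_n) : Z^T = Z -> P^T = P -> S^T = S ->
  \tr (Z *m ((A - G *m P) *m S + S *m (A - G *m P)^T + D)) =
  2 * \tr (Z *m A *m S) - 2 * \tr (Z *m G *m P *m S) + \tr (Z *m D).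
Proof.
move=> sZ sP sS.
have e1 : \tr (Z *m S *m A^T) = \tr (Z *m A *m S).
  rewrite -mxtrace_tr !trmx_mul trmxK sS sZ.
  by rewrite mxtrace_mulC -mulmxA mxtrace_mulC.
have e2 : \tr (Z *m S *m P *m G) = \tr (Z *m G *m P *m S).
  rewrite -mxtrace_tr !trmx_mul sP sZ sS hG.
  by rewrite !mulmxA mxtrace_mulC !mulmxA.
rewrite [(A - _)^T]linearB /= trmx_mul hG sP.
rewrite !(mulmxDl, mulmxDr, mulNmx, mulmxN) !mulmxA.
by rewrite !(mxtraceD, mxtraceN) e1 e2; ring.
Qed.

(** Completing the square: only [P1] drives [S], the terms in [A], [Q] and [D] cancel, and the three
    terms in [G] assemble into one square. [c1] and [c2] stand for primitives of [tr (P D)]. *)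
Lemma dual_gap_derive (t : R) (P1 P2 S : R -> 'M[R]_n) (c1 c2 : R -> R) :
  is_derive t 1 P1 (- field (P1 t)) -> is_derive t 1 P2 (- field (P2 t)) ->
  is_derive t 1 S ((A - G *m P1 t) *m S t + S t *m (A - G *m P1 t)^T + D) ->
  is_derive t 1 c1 (\tr (P1 t *m D)) -> is_derive t 1 c2 (\tr (P2 t *m D)) ->
  (P1 t)^T = P1 t -> (P2 t)^T = P2 t -> (S t)^T = S t ->
  is_derive t 1 (fun u => \tr ((P1 u - P2 u) *m S u) - (c1 u - c2 u))
    (- \tr ((P1 t - P2 t) *m G *m (P1 t - P2 t) *m S t)).
Proof.
move=> D1 D2 DS Dc1 Dc2; set U := P1 t; set V := P2 t; set W := S t.
move=> sU sV sW; apply: is_derive_eq.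
have sUV : (U - V)^T = U - V by rewrite linearB /= sU sV.
have E : \tr ((- field U - - field V) *m W + (U - V) *m
     ((A - G *m U) *m W + W *m (A - G *m U)^T + D)) -
   (\tr (U *m D) - \tr (V *m D)) = - \tr ((U - V) *m G *m (U - V) *m W).
  rewrite mxtraceD mxtrace_cov_field// mulmxDl mulNmx opprK.
  rewrite mxtraceD mxtraceN !mxtrace_riccati_field//.
  rewrite !(mulmxBl, mulmxBr) !mxtraceB.
  have -> : \tr (U *m G *m V *m W) = \tr (V *m G *m U *m W).
    by rewrite -mxtrace_tr !trmx_mul sU sV sW hG mxtrace_mulC !mulmxA.
  ring.
exact: E.
Qed.

(** The derivative is minus twice the running cost: for the gain [K = - R^-1 B^T P] one has
    [tr (K^T R K S) = tr (P G P S)]. *)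
Lemma cost_to_go_derive (t : R) (P S : R -> 'M[R]_n) (c : R -> R) :
  is_derive t 1 P (- field (P t)) ->
  is_derive t 1 S ((A - G *m P t) *m S t + S t *m (A - G *m P t)^T + D) ->
  is_derive t 1 c (- \tr (P t *m D)) -> (P t)^T = P t -> (S t)^T = S t ->
  is_derive t 1 (fun u => \tr (P u *m S u) - varpi * u + c u)
    (- (\tr (Q *m S t) + \tr (P t *m G *m P t *m S t) + varpi)).
Proof.
move=> DP DS Dc; set U := P t; set W := S t; move=> sU sW.
apply: is_derive_eq.
have E : \tr (- field U *m W + U *m
     ((A - G *m U) *m W + W *m (A - G *m U)^T + D)) - varpi * 1 - \tr (U *m D) =
    - (\tr (Q *m W) + \tr (U *m G *m U *m W) + varpi).
  rewrite mxtraceD mxtrace_cov_field// mulNmx mxtraceN mxtrace_riccati_field//.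
  ring.
exact: E.
Qed.

(* Twice the Hamiltonian of the problem, see [hamiltonianE]. *)
Definition riccati_hamiltonian (S P : 'M[R]_n) : R :=
  varpi + \tr (field P *m S) + \tr (P *m D).

(** Conservation of energy: the two equations are the canonical ones, [P'] being minus the
    derivative in [S] and [S'] the derivative in [P]. In the computation [F] replaces [field U], of
    which only the symmetry matters. *)
Lemma riccati_hamiltonian_derive (t : R) (P S : R -> 'M[R]_n) :
  is_derive t 1 P (- field (P t)) ->
  is_derive t 1 S ((A - G *m P t) *m S t + S t *m (A - G *m P t)^T + D) ->
  (P t)^T = P t -> (S t)^T = S t ->
  is_derive t 1 (fun u => riccati_hamiltonian (S u) (P u)) 0.
Proof.
move=> DP DS; set U := P t; set W := S t; move=> sU sW.
rewrite /riccati_hamiltonian /riccati_field; apply: is_derive_eq.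
rewrite -/U -/W.
have sF : (field U)^T = field U.
  rewrite /riccati_field !(linearD, linearN) /= !trmx_mul trmxK hQ hG sU.
  by rewrite !mulmxA; congr (_ - _); exact: addrAC.
have E (F : 'M[R]_n) : F^T = F ->
   0 + \tr ((0 + (0 *m U + A^T *m - F) + (- F *m A + U *m 0) -
   ((- F *m G + U *m 0) *m U + U *m G *m - F)) *m W +
   F *m ((A - G *m U) *m W + W *m (A - G *m U)^T + D)) +
   \tr (- F *m D + U *m 0) = 0.
  move=> {}sF; rewrite !(mulmx0, mul0mx, add0r, addr0) mxtraceD mxtrace_cov_field//.
  rewrite !(mulmxDl, mulNmx, mulmxN) !(mxtraceD, mxtraceN).
  have -> : \tr (A^T *m F *m W) = \tr (F *m A *m W).
    by rewrite -mxtrace_tr !trmx_mul trmxK sF sW mxtrace_mulC.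
  have -> : \tr (U *m G *m F *m W) = \tr (F *m G *m U *m W).
    by rewrite -mxtrace_tr !trmx_mul sU sF sW hG mxtrace_mulC !mulmxA.
  ring.
exact: E sF.
Qed.

Definition dual_integral (s : R) (P : 'M[R]_n) : R :=
  \int[lebesgue_measure]_(u in `[0, s]) \tr (p u P *m D).

Lemma dual_integralP s P : 0 < s -> good s P ->
  [/\ dual_integral 0 P = 0, {within `[0, s], continuous (dual_integral ^~ P)} &
    forall t, 0 < t < s -> is_derive t 1 (dual_integral ^~ P) (\tr (p t P *m D))].
Proof.
move=> s0 gP; apply: (antiderivative s0).
apply: continuous_in_subspaceT => t; rewrite inE /= in_itv /= => t0s.
apply: cvg_mxtrace; apply: cvg_mulmx; last exact: cvg_cst.
exact: (@riccati_cvg _ _ A G Q _ _ _ id t P cvg_id (gP _ t0s)).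
Qed.

Lemma within_riccati s P : good s P -> {within `[0, s], continuous (p ^~ P)}.
Proof.
move=> gP; apply: continuous_in_subspaceT => t; rewrite inE /= in_itv /= => t0s.
exact: (@riccati_cvg _ _ A G Q _ _ _ id t P cvg_id (gP _ t0s)).
Qed.

Lemma is_derive_riccati_backward (s t : R) P : good s P -> 0 <= s - t <= s ->
  is_derive t 1 (fun u => p (s - u) P) (- field (p (s - t) P)).
Proof.
move=> gP st; apply: (@is_derive_mx_reflect _ _ _ (p ^~ P)).
by apply: is_derive_riccati; exact: gP.
Qed.

(* The covariance trajectory on [0, s] driven by the gain attached to the
   Riccati solution with terminal value [P]. *)
Definition cov_flow (s : R) (P S0 : 'M[R]_n) (S : R -> 'M[R]_n) : Prop :=
  [/\ {within `[0, s], continuous S},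
      forall t, 0 < t < s -> is_derive t 1 S
        ((A - G *m p (s - t) P) *m S t + S t *m (A - G *m p (s - t) P)^T + D),
      S 0 = S0 & forall t, 0 <= t <= s -> mx_posdef (S t)].

(* Twice the optimal cost-to-go at time [t], up to an additive constant. *)
Definition cost_to_go (s : R) (P : 'M[R]_n) (S : R -> 'M[R]_n) (t : R) : R :=
  \tr (p (s - t) P *m S t) - varpi * t + dual_integral (s - t) P.

(* Twice the dual functional: its maximum over the terminal co-state [P] is
   twice the optimal cost, see [dual_value_le]. *)
Definition dual_value (S0 Sf : 'M[R]_n) (s : R) (P : 'M[R]_n) : R :=
  \tr (p s P *m S0) - \tr (P *m Sf) + varpi * s + dual_integral s P.

(** * The duality gap on a time window *)

Section Window.
Variables (s : R) (P S0 : 'M[R]_n) (S : R -> 'M[R]_n).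
Hypotheses (s0 : 0 < s) (sP : P^T = P) (gP : good s P) (fS : cov_flow s P S0 S).

Let P1 t := p (s - t) P.

(** The competitor has terminal value [P2] at time [b], which may precede the final time [s]. Since
    [gap] has derivative [- defect], the duality gap on [a, b] is [gap a - gap b]. *)
Let gap (b : R) (P2 : 'M[R]_n) (t : R) : R :=
  \tr ((P1 t - p (b - t) P2) *m S t) -
  (- dual_integral (s - t) P - - dual_integral (b - t) P2).

Let defect (b : R) (P2 : 'M[R]_n) (t : R) : R :=
  \tr ((P1 t - p (b - t) P2) *m G *m (P1 t - p (b - t) P2) *m S t).

Let within_P1 : {within `[0, s], continuous P1}.
Proof.
apply: (@within_continuous_reflect _ _ (p ^~ P)); rewrite subrr subr0.
exact: within_riccati.
Qed.

Let within_integral : {within `[0, s], continuous (fun t => dual_integral (s - t) P)}.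
Proof.
apply: (@within_continuous_reflect _ _ (dual_integral ^~ P)); rewrite subrr subr0.
by have [] := dual_integralP s0 gP.
Qed.

Let P1_sym t : 0 <= t <= s -> (P1 t)^T = P1 t.
Proof. by move=> ts; apply: riccati_sym => //; apply: gP; lra. Qed.

Let S_sym t : 0 <= t <= s -> (S t)^T = S t.
Proof. by move=> ts; have [_ _ _ /(_ t ts)[]] := fS. Qed.

Let derive_P1 (t : R) : 0 < t < s -> is_derive t 1 P1 (- field (P1 t)).
Proof. by move=> ts; apply: is_derive_riccati_backward => //; lra. Qed.

Let derive_integral (u : R) P2 (t : R) : 0 < u -> good u P2 -> 0 < u - t < u ->
  is_derive t 1 (fun t => dual_integral (u - t) P2) (- \tr (p (u - t) P2 *m D)).
Proof.
move=> u0 gP2 ut; apply: (@is_derive_reflect _ (dual_integral ^~ P2)).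
by have [_ _] := dual_integralP u0 gP2; apply.
Qed.

Section GapOnWindow.
Variables (a b : R) (P2 : 'M[R]_n).
Hypotheses (a0 : 0 <= a) (ab : a < b) (bs : b <= s) (sP2 : P2^T = P2).
Hypothesis gP2 : good (b - a) P2.

Let ba0 : 0 < b - a. Proof. by rewrite subr_gt0. Qed.

Lemma gap_continuous : {within `[a, b], continuous (gap b P2)}.
Proof.
have [Sc _ _ _] := fS; have [_ Ic2 _] := dual_integralP ba0 gP2.
have sub : `[a, b] `<=` `[0, s] by apply: subset_itv; rewrite bnd_simp.
have c1 : {within `[a, b], continuous P1} by exact: continuous_subspaceW within_P1.
have c2 : {within `[a, b], continuous (fun t => p (b - t) P2)}.
  by apply: (@within_continuous_reflect _ _ (p ^~ P2)); rewrite subrr; exact: within_riccati.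
have c3 : {within `[a, b], continuous S} by exact: continuous_subspaceW Sc.
have c4 : {within `[a, b], continuous (fun t => dual_integral (s - t) P)}.
  exact: continuous_subspaceW within_integral.
have c5 : {within `[a, b], continuous (fun t => dual_integral (b - t) P2)}.
  apply: (@within_continuous_reflect _ _ (dual_integral ^~ P2)); rewrite subrr.
  exact: Ic2.
move=> t; apply: cvgB.
  apply: cvg_mxtrace; apply: cvg_mulmx; last exact: c3.
  by apply: cvgB; [exact: c1|exact: c2].
by apply: cvgB; apply: cvgN; [exact: c4|exact: c5].
Qed.

Let P2_sym t : a <= t <= b -> (p (b - t) P2)^T = p (b - t) P2.
Proof. by move=> tab; apply: riccati_sym => //; apply: gP2; lra. Qed.

Lemma gap_derive (t : R) : a < t < b -> is_derive t 1 (gap b P2) (- defect b P2 t).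
Proof.
have a0' := a0; have ab' := ab; have bs' := bs.
move=> tab; have t0s : 0 < t < s by lra.
have tab' : a <= t <= b by lra.
have t0s' : 0 <= t <= s by lra.
have [_ DS _ _] := fS; have [_ _ DI2] := dual_integralP ba0 gP2.
apply: (@dual_gap_derive t P1 (fun u => p (b - u) P2) S
  (fun u => - dual_integral (s - u) P) (fun u => - dual_integral (b - u) P2));
  [exact: derive_P1| |exact: DS| | |exact: P1_sym|exact: P2_sym|exact: S_sym].
- apply: (@is_derive_mx_reflect _ _ _ (p ^~ P2)).
  by apply: is_derive_riccati; apply: gP2; lra.
- rewrite -[X in is_derive _ _ _ X]opprK; apply: is_derive_opp.
  by apply: derive_integral => //; lra.
- rewrite -[X in is_derive _ _ _ X]opprK; apply: is_derive_opp.
  by apply: (@is_derive_reflect _ (dual_integral ^~ P2)); apply: DI2; lra.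
Qed.

Lemma defect_ge0 t : a <= t <= b -> 0 <= defect b P2 t.
Proof.
have a0' := a0; have ab' := ab; have bs' := bs.
move=> tab; have t0s : 0 <= t <= s by lra.
have [_ _ _ pS] := fS; apply: mx_psd_trace_mul_ge0; last exact/mx_posdef_psd/pS.
have sE : (P1 t - p (b - t) P2)^T = P1 t - p (b - t) P2.
  by rewrite linearB /= P1_sym// P2_sym.
by rewrite -{1}sE; exact: mx_psd_conj.
Qed.

(** Weak duality for a piece of the trajectory: the left side is the dual functional of the problem
    of length [b - a] whose boundary covariances are the values [S a] and [S b] actually taken. It
    holds because [gap] is nonincreasing. *)
Lemma cost_to_go_window :
  \tr (p (b - a) P2 *m S a) - \tr (P2 *m S b) + varpi * (b - a) +
    dual_integral (b - a) P2 <= cost_to_go s P S a - cost_to_go s P S b.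
Proof.
have a0' := a0; have ab' := ab; have bs' := bs.
have : gap b P2 b <= gap b P2 a.
  apply: (derive_le0_nincr (ltW ab) gap_continuous gap_derive) => t tab.
  by rewrite oppr_le0; apply: defect_ge0; lra.
have [I2 _ _] := dual_integralP ba0 gP2.
rewrite /gap /cost_to_go -/(P1 a) -/(P1 b) subrr riccati0 I2.
rewrite !mulmxBl !mxtraceB.
move: (\tr (P1 b *m S b)) (\tr (P2 *m S b)) (\tr (P1 a *m S a)).
move: (\tr (p (b - a) P2 *m S a)) (dual_integral (b - a) P2).
by move: (dual_integral (s - a) P) (dual_integral (s - b) P) => *; lra.
Qed.

End GapOnWindow.

Lemma cost_to_go_nincr a b : 0 <= varpi -> 0 <= a -> a <= b -> b <= s ->
  cost_to_go s P S b <= cost_to_go s P S a.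
Proof.
move=> v0 a0 ab bs; have [Sc DS _ pS] := fS.
have sub : `[a, b] `<=` `[0, s] by apply: subset_itv; rewrite bnd_simp.
apply: (@derive_le0_nincr _ (cost_to_go s P S) (fun t => - (\tr (Q *m S t) +
  \tr (P1 t *m G *m P1 t *m S t) + varpi)) a b) => //.
- apply: (continuous_subspaceW sub) => t; apply: cvgD; last exact: within_integral.
  apply: cvgB.
    by apply: cvg_mxtrace; apply: cvg_mulmx; [exact: within_P1|exact: Sc].
  apply: cvgM; first exact: cvg_cst.
  by apply: continuous_subspaceT => u; exact: cvg_id.
- move=> t tab; have t0s : 0 < t < s by lra.
  have t0s' : 0 <= t <= s by lra.
  apply: (@cost_to_go_derive t P1 S (fun u => dual_integral (s - u) P));
    [exact: derive_P1|exact: DS| |exact: P1_sym|exact: S_sym].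
  by apply: derive_integral => //; lra.
- move=> t tab; have t0s : 0 <= t <= s by lra.
  rewrite oppr_le0 !addr_ge0//; apply: mx_psd_trace_mul_ge0 => //;
    try exact/mx_posdef_psd/pS.
  by rewrite -{1}(P1_sym t0s); exact: mx_psd_conj.
Qed.

Lemma riccati_hamiltonian_const t : 0 <= t <= s ->
  riccati_hamiltonian (S t) (P1 t) = riccati_hamiltonian (S 0) (P1 0).
Proof.
move=> /andP[t0 ts]; have [Sc DS _ pS] := fS.
have sub : `[0, t] `<=` `[0, s] by apply: subset_itvl; rewrite bnd_simp.
pose h u := riccati_hamiltonian (S u) (P1 u).
suff : `|h t - h 0| <= 0 * (t - 0).
  by rewrite mul0r normr_le0 subr_eq0 => /eqP.
apply: (@derive_bounded_lipschitz _ h (fun=> 0) 0 t 0); first exact: t0.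
- apply: (continuous_subspaceW sub) => u; apply: cvgD; last first.
    by apply: cvg_mxtrace; apply: cvg_mulmx; [exact: within_P1|exact: cvg_cst].
  apply: cvgD; first exact: cvg_cst.
  apply: cvg_mxtrace; apply: cvg_mulmx; last exact: Sc.
  apply: cvgB; last first.
    apply: cvg_mulmx; last exact: within_P1.
    by apply: cvg_mulmx; [exact: within_P1|exact: cvg_cst].
  apply: cvgD; last by apply: cvg_mulmx; [exact: within_P1|exact: cvg_cst].
  by apply: cvgD; [exact: cvg_cst|apply: cvg_mulmx; [exact: cvg_cst|exact: within_P1]].
- move=> u u0t; have u0s : 0 < u < s by lra.
  have u0s' : 0 <= u <= s by lra.
  apply: (@riccati_hamiltonian_derive u P1 S);
    [exact: derive_P1|exact: DS|exact: P1_sym|exact: S_sym].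
- by move=> u _; rewrite normr0.
Qed.

Lemma dual_value_le (Sf P2 : 'M[R]_n) : S s = Sf -> P2^T = P2 -> good s P2 ->
  dual_value S0 Sf s P2 <= dual_value S0 Sf s P.
Proof.
have s0' := s0.
move=> Ss sP2 gP2; have [_ _ SE _] := fS.
have gP2' : good (s - 0) P2 by rewrite subr0.
have [I1 _ _] := dual_integralP s0 gP.
have := cost_to_go_window (lexx 0) s0 (lexx s) sP2 gP2'.
rewrite /cost_to_go /dual_value (subr0 s) (subrr s) riccati0 I1 SE Ss.
move: (\tr (p s P *m S0)) (\tr (p s P2 *m S0)) (\tr (P *m Sf)) (\tr (P2 *m Sf)).
by move: (dual_integral s P) (dual_integral s P2) => *; lra.
Qed.

(** Equal dual values give the nonincreasing [gap] equal end values, so it is constant and [defect]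
    vanishes inside; [S t] being positive definite, the zero trace becomes a zero matrix. *)
Lemma dual_value_eq (Sf P2 : 'M[R]_n) : S s = Sf -> P2^T = P2 -> good s P2 ->
  dual_value S0 Sf s P2 = dual_value S0 Sf s P ->
  forall t, 0 < t < s -> (p (s - t) P - p (s - t) P2) *m G *m
    (p (s - t) P - p (s - t) P2) = 0.
Proof.
have s0' := s0.
move=> Ss sP2 gP2 Deq t t0s; have [_ _ SE pS] := fS.
have gP2' : good (s - 0) P2 by rewrite subr0.
have [I1 _ _] := dual_integralP s0 gP; have [I2 _ _] := dual_integralP s0 gP2.
have g0s : gap s P2 0 = gap s P2 s.
  move: Deq; rewrite /gap /P1 /dual_value !(subr0 s) (subrr s) !riccati0 I1 I2 SE Ss.
  rewrite !mulmxBl !mxtraceB.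
  move: (\tr (p s P *m S0)) (\tr (p s P2 *m S0)) (\tr (P *m Sf)) (\tr (P2 *m Sf)).
  move: (dual_integral s P) (dual_integral s P2) => *; clear I1 I2; lra.
have t0s' : 0 <= t <= s by case/andP: t0s => /ltW -> /ltW ->.
have Dg := gap_derive (lexx 0) s0 (lexx s) sP2 gP2'.
have nincr a b : 0 <= a -> a <= b -> b <= s -> gap s P2 b <= gap s P2 a.
  move=> a0 ab bs; have sub : `[a, b] `<=` `[0, s].
    by apply: subset_itv; rewrite bnd_simp.
  apply: (@derive_le0_nincr _ (gap s P2) (fun t => - defect s P2 t) a b ab).
  - exact: (continuous_subspaceW sub (gap_continuous (lexx 0) s0 (lexx s) gP2')).
  - move=> u /andP[au ub]; apply: Dg.
    by rewrite (le_lt_trans a0 au) (lt_le_trans ub bs).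
  - move=> u /andP[au ub]; rewrite oppr_le0.
    apply: (defect_ge0 (lexx 0) s0 (lexx s) sP2 gP2').
    by rewrite (le_trans a0 (ltW au)) (le_trans (ltW ub) bs).
have gap_cst u : 0 <= u <= s -> gap s P2 u = gap s P2 0.
  case/andP => u0 us; have gu0 := nincr 0 u (lexx 0) u0 us.
  have gsu := nincr u s u0 us (lexx s).
  by apply/le_anti; rewrite gu0 g0s.
have : - defect s P2 t = 0.
  have /@derive_val <- := Dg t t0s.
  rewrite (near_eq_derive (g := cst (gap s P2 0))); first by rewrite derive_cst.
  case/andP: t0s => t0' ts'; near=> u; apply: gap_cst.
  by apply/andP; split; apply: ltW; near: u; [exact: lt_nbhsr|exact: lt_nbhsl].
move=> /eqP; rewrite oppr_eq0 => /eqP.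
apply: mx_psd_posdef_trace_eq0; last exact: pS.
have sE : (P1 t - p (s - t) P2)^T = P1 t - p (s - t) P2.
  have st : 0 <= s - t <= s.
    by case/andP: t0s' => t0' ts'; rewrite subr_ge0 ts' gerBl.
  by rewrite linearB /= (P1_sym t0s') (riccati_sym hG hQ sP2 (gP2 _ st)).
by rewrite -{1}sE; exact: mx_psd_conj.
Unshelve. all: by end_near. Qed.

(** First-order expansion in the terminal co-state. After the linear term in [S s - Sf] is removed,
    the remainder is exactly the total variation of [gap], the integral of a form quadratic in the
    difference of two Riccati solutions, which is Lipschitz in [P2 - P]. Here [S] need not reach
    [Sf]. *)
Lemma dual_value_gap (Sf : 'M[R]_n) : exists rho K : R, [/\ 0 < rho, 0 < K &
  forall P2, P2^T = P2 -> `|P2 - P| <= rho -> good s P2 /\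
    `|dual_value S0 Sf s P - dual_value S0 Sf s P2 -
      \tr ((P - P2) *m (S s - Sf))| <= K * `|P2 - P| ^+ 2].
Proof.
have s0' := s0.
have [rho [C [rho0 C0 HC]]] := riccati_lipschitz hG hQ (ltW s0) sP gP.
have [Sc _ SE pS] := fS; have [c c0 Sb] := within_continuous_bounded Sc.
pose N : R := n%:R; have N0 : 0 <= N by rewrite ler0n.
(* Bounds [tr (E G E S)]: one [N] for the trace and one for each product, [C] for each [E], [c] for
   [S]. *)
pose L := N * (N * (N * (N * C * `|G|) * C) * c).
have L0 : 0 <= L by rewrite !mulr_ge0// ltW.
exists rho, (L * s + 1); split=> // [|P2 sP2 P2rho].
  by rewrite ltr_wpDl// mulr_ge0// ltW.
have [gP2 lip] := HC P2 P2rho; split=> //.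
have gP2' : good (s - 0) P2 by rewrite subr0.
have [I1 _ _] := dual_integralP s0 gP; have [I2 _ _] := dual_integralP s0 gP2.
set d := `|P2 - P| in lip *; have d0 : 0 <= d by exact: normr_ge0.
have : `|gap s P2 s - gap s P2 0| <= L * d ^+ 2 * (s - 0).
  apply: (@derive_bounded_lipschitz _ (gap s P2) (fun t => - defect s P2 t) 0 s _ (ltW s0)).
  - exact: (gap_continuous (lexx 0) s0 (lexx s) gP2').
  - exact: (gap_derive (lexx 0) s0 (lexx s) sP2 gP2').
  - move=> t t0s; rewrite normrN /defect.
    have [t0 ts] := andP t0s; have t0s' : 0 <= t <= s by rewrite (ltW t0) ltW.
    have st : 0 <= s - t <= s by rewrite subr_ge0 gerBl (ltW t0) ltW.
    have Eb : `|P1 t - p (s - t) P2| <= C * d by rewrite distrC; exact: lip.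
    have Stb := Sb t t0s'.
    set E := P1 t - _ in Eb *.
    have -> : L * d ^+ 2 = N * (N * (N * (N * (C * d) * `|G|) * (C * d)) * c).
      by rewrite /L; ring.
    rewrite (le_trans (normr_mxtrace _))// ler_wpM2l//.
    rewrite (le_trans (mx_normrM _ _))// ler_pM ?mulr_ge0// ler_wpM2l//.
    rewrite (le_trans (mx_normrM _ _))// ler_pM ?mulr_ge0// ler_wpM2l//.
    by rewrite (le_trans (mx_normrM _ _))// ler_wpM2r// ler_wpM2l.
rewrite subr0 => gapb.
have -> : dual_value S0 Sf s P - dual_value S0 Sf s P2 - \tr ((P - P2) *m (S s - Sf))
   = - (gap s P2 s - gap s P2 0).
  rewrite /gap /P1 /dual_value !(subr0 s) (subrr s) !riccati0 I1 I2 SE.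
  rewrite !mulmxBr !mulmxBl !mxtraceB.
  move: (\tr (p s P *m S0)) (\tr (p s P2 *m S0)) (\tr (P *m Sf)) (\tr (P2 *m Sf)).
  move: (\tr (P *m S s)) (\tr (P2 *m S s)).
  by move: (dual_integral s P) (dual_integral s P2) => *; ring.
rewrite normrN (le_trans gapb)// mulrDl mul1r mulrAC lerDl.
by rewrite exprn_ge0.
Qed.

End Window.

End Duality.

(** * Covariance trajectories *)

Lemma mx_antiderivative (R : realType) (n : nat) (f : R -> 'M[R]_n) (a b : R) :
  a < b -> {within `[a, b], continuous f} ->
  (forall t, (f t)^T = f t) -> exists F : R -> 'M[R]_n,
    [/\ F a = 0, {within `[a, b], continuous F}, forall t, (F t)^T = F t &
        forall t : R, a < t < b -> is_derive t 1 F (f t)].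
Proof.
move=> ab fc sf.
have fijc i j : {within `[a, b], continuous (fun u => f u i j)}.
  by move=> u; move/mx_cvgP : (fc u); apply.
pose F (t : R) : 'M[R]_n :=
  \matrix_(i, j) \int[lebesgue_measure]_(u in `[a, t]) f u i j.
exists F; split.
- apply/matrixP => i j; rewrite !mxE; have [-> _ _] := antiderivative ab (fijc i j).
  by [].
- move=> u; apply/mx_cvgP => i j; have [_ Fc _] := antiderivative ab (fijc i j).
  have FE : (fun t => \int[lebesgue_measure]_(v in `[a, t]) f v i j) =
      (fun t => F t i j) by apply/funext => t; rewrite mxE.
  by have := Fc u; rewrite FE.
- move=> t; apply/matrixP => i j; rewrite !mxE; congr (Rintegral _ _ _).
  by apply/funext => u; rewrite -{1}[f u]sf mxE.
- move=> t tab; apply/is_derive_mxP => i j; under eq_fun do rewrite mxE.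
  by have [_ _ DF] := antiderivative ab (fijc i j); exact: DF.
Qed.

Section CovarianceFlow.
Variables (R : realType) (n : nat) (A G Q D : 'M[R]_n).
Hypothesis pD : mx_psd D.

Local Notation p := (riccati A G Q).
Local Notation X := (ham_state A G Q).
Local Notation Y := (ham_costate A G Q).

Lemma mx_posdef_conj (M C : 'M[R]_n) : mx_posdef M -> C \in unitmx ->
  mx_posdef (C *m M *m C^T).
Proof.
move=> pM uC; split.
  by have [] := mx_psd_conj C^T (mx_posdef_psd pM); rewrite trmxK.
move=> x x0; have := pM.2 (C^T *m x); rewrite trmx_mul trmxK !mulmxA; apply.
apply: contra x0 => /eqP/(congr1 (mulmx (invmx C^T))).
by rewrite mulKmx ?unitmx_tr// mulmx0 => ->.
Qed.

Lemma mx_posdefDpsd (M N : 'M[R]_n) : mx_posdef M -> mx_psd N -> mx_posdef (M + N).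
Proof.
move=> [sM pM] [sN pN]; split; first by rewrite /mx_symmetric linearD /= sM sN.
by move=> x x0; rewrite mulmxDr mulmxDl mxE ltr_pwDl// pM.
Qed.

(* Variation of constants: with [Z t = X (s - t)] a fundamental matrix of the
   closed loop, [S = Z (Z_0^-1 S0 Z_0^-T + int Z^-1 D Z^-T) Z^T]. *)
Lemma cov_flow_exists (s : R) (P S0 : 'M[R]_n) : 0 < s -> no_escape A G Q s P ->
  mx_posdef S0 -> exists S, cov_flow A G Q D s P S0 S.
Proof.
move=> s0 gP pS0; pose I t := invmx (X (s - t) P).
pose f t := I t *m D *m (I t)^T.
have Zu t : 0 <= t <= s -> X (s - t) P \in unitmx.
  by move=> /andP[t0 ts]; apply: gP; rewrite subr_ge0 ts gerBl.
have Zc : {within `[0, s], continuous (fun t => X (s - t) P)}.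
  apply: (@within_continuous_reflect _ _ (X ^~ P)).
  apply: continuous_subspaceT; exact: ham_state_continuous.
have Ic : {within `[0, s], continuous I}.
  apply: (@within_continuous_reflect _ _ (fun t => invmx (X t P))).
  rewrite subrr subr0; apply: continuous_in_subspaceT => t.
  rewrite inE /= in_itv /= => t0s; apply: cvg_invmx; last exact: gP.
  exact: ham_state_continuous.
have fc : {within `[0, s], continuous f}.
  move=> t; apply: cvg_mulmx; last by apply: cvg_trmx; exact: Ic.
  by apply: cvg_mulmx; [exact: Ic|exact: cvg_cst].
have sf t : (f t)^T = f t by rewrite /f !trmx_mul trmxK pD.1 mulmxA.
have [F [F0 Fc sF DF]] := mx_antiderivative s0 fc sf.
have pF t : 0 <= t <= s -> mx_psd (F t).
  move=> /andP[t0 ts]; split; first exact: sF.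
  move=> x; pose h u := - \tr (x^T *m F u *m x).
  have sub : `[0, t] `<=` `[0, s] by apply: subset_itvl; rewrite bnd_simp.
  suff : h t <= h 0.
    by rewrite /h F0 mulmx0 mul0mx mxtrace0 oppr0 oppr_le0 trace_mx11.
  apply: (@derive_le0_nincr _ h (fun u => - \tr (x^T *m f u *m x)) 0 t t0).
  - apply: (continuous_subspaceW sub) => u; apply: cvgN; apply: cvg_mxtrace.
    apply: cvg_mulmx; last exact: cvg_cst.
    by apply: cvg_mulmx; [exact: cvg_cst|exact: Fc].
  - move=> u /andP[u0 ut]; have u0s : 0 < u < s by rewrite u0 (lt_le_trans ut ts).
    have DFu := DF u u0s; apply: is_derive_opp.
    by apply: is_derive_eq; rewrite mul0mx add0r mulmx0 addr0.
  - move=> u _; rewrite oppr_le0 trace_mx11 /f.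
    have := pD.2 ((I u)^T *m x); rewrite trmx_mul trmxK.
    by rewrite !mulmxA.
pose N t := I 0 *m S0 *m (I 0)^T + F t.
exists (fun t => X (s - t) P *m N t *m (X (s - t) P)^T); split.
- move=> t; apply: cvg_mulmx; last by apply: cvg_trmx; exact: Zc.
  apply: cvg_mulmx; first exact: Zc.
  by apply: cvgD; [exact: cvg_cst|exact: Fc].
- move=> t t0s; have t0s' : 0 <= t <= s by case/andP: t0s => /ltW -> /ltW ->.
  have DZ := is_derive_mx_reflect (is_derive_ham_state A G Q (s - t) P).
  have DFt := DF t t0s; have DN : is_derive t 1 N (f t).
    by apply: is_derive_eq (is_derive_add (is_derive_const _ _) DFt) _; rewrite add0r.
  apply: is_derive_eq.
  have uZ := Zu t t0s'.
  have E (Z V W : 'M[R]_n) : Z \in unitmx -> 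
     (- (- A *m Z + G *m V) *m W + Z *m (invmx Z *m D *m (invmx Z)^T)) *m Z^T +
     Z *m W *m (- (- A *m Z + G *m V))^T =
     (A - G *m (V *m invmx Z)) *m (Z *m W *m Z^T) +
     Z *m W *m Z^T *m (A - G *m (V *m invmx Z))^T + D.
    move=> Zun; have -> : - (- A *m Z + G *m V) = (A - G *m (V *m invmx Z)) *m Z.
      by rewrite mulmxBl !mulmxA mulmxKV// opprD mulNmx opprK.
    set K := A - _; rewrite trmx_mul mulmxDl !mulmxA mulmxV// mul1mx.
    by rewrite -[D *m _ *m _]mulmxA trmx_inv mulVmx ?unitmx_tr// mulmx1 addrAC.
  exact: E.
- rewrite /N F0 addr0 /I subr0 !mulmxA mulmxV; last by apply: gP; rewrite lexx ltW.
  rewrite mul1mx -mulmxA trmx_inv mulVmx ?mulmx1// unitmx_tr.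
  by apply: gP; rewrite lexx ltW.
- move=> t t0s; apply: mx_posdef_conj; last exact: Zu.
  apply: mx_posdefDpsd; last exact: pF.
  apply: mx_posdef_conj => //; rewrite unitmx_inv; apply: Zu.
  by rewrite lexx ltW.
Qed.

End CovarianceFlow.

(** * From the boundary value problem to terminal co-states *)

Section BoundaryValueProblem.
Variables (R : realType) (n m : nat) (A : 'M[R]_n) (B : 'M[R]_(n, m)).
Variables (D Q : 'M[R]_n) (Rw : 'M[R]_m) (varpi : R).
Hypotheses (pQ : mx_psd Q) (pRw : mx_posdef Rw).

Let G : 'M[R]_n := B *m invmx Rw *m B^T.

Lemma control_weight_psd : mx_psd G.
Proof.
rewrite /G -{1}[B]trmxK; apply: mx_psd_conj.
exact/mx_posdef_psd/mx_posdef_inv.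
Qed.

(** [G] may be singular, but [E G E] is the form of the positive definite [R^-1] at [B^T E], so
    [B^T E] vanishes. *)
Lemma control_weight_eq0 (E : 'M[R]_n) : E^T = E -> E *m G *m E = 0 -> G *m E = 0.
Proof.
move=> sE EGE; suff BE : B^T *m E = 0 by rewrite /G -mulmxA BE mulmx0.
apply: (mx_posdef_quad_eq0 (mx_posdef_inv pRw)).
have -> : (B^T *m E)^T *m invmx Rw *m (B^T *m E) = E *m G *m E.
  by rewrite trmx_mul trmxK sE /G !mulmxA.
by rewrite EGE mxtrace0.
Qed.

Lemma hamiltonianE (S P : 'M[R]_n) : P^T = P -> S^T = S ->
  hamiltonian A B D Q Rw varpi S P =
  2^-1 * riccati_hamiltonian A G Q D varpi S P.
Proof.
move=> sP sS; rewrite /hamiltonian /riccati_hamiltonian.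
rewrite (mxtrace_riccati_field _ _ _ sP sS).
have -> : P *m B *m invmx Rw *m B^T *m P *m S = P *m G *m P *m S.
  by rewrite /G !mulmxA.
rewrite mxtraceD mxtraceB !mxtraceZ.
move: (\tr (Q *m S)) (\tr (P *m A *m S)) (\tr (P *m G *m P *m S)) (\tr (P *m D)).
by move=> *; field.
Qed.

Variables (Sigma0 Sigmaf : 'M[R]_n) (s : R).
Hypothesis s0 : 0 < s.

(** With the converse [cov_flow_bvp], this identifies solutions of the boundary value problem with
    terminal co-states whose driven covariance ends at [Sigmaf], so uniqueness of trajectories
    becomes uniqueness of one matrix. *)
Lemma bvp_cov_flow (S P : R -> 'M[R]_n) :
  bvp_solution A B D Q Rw Sigma0 Sigmaf s S P ->
  [/\ (P s)^T = P s, no_escape A G Q s (P s),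
      forall t, 0 <= t <= s -> P t = riccati A G Q (s - t) (P s),
      cov_flow A G Q D s (P s) Sigma0 S & S s = Sigmaf].
Proof.
move=> [[Sc Pc] pSP DP DS [S0E SsE]].
have ss : 0 <= s <= s by rewrite ltW/=.
have DP' t : 0 < t < s -> is_derive t 1 P (- riccati_field A G Q (P t)).
  move=> t0s; apply: is_derive_eq (DP t t0s) _.
  have -> : P t *m B *m invmx Rw *m B^T *m P t = P t *m G *m P t by rewrite /G !mulmxA.
  by rewrite /riccati_field !opprD opprK.
have [gP PE] := riccati_unique (ltW s0) Pc DP'.
split=> //; first exact: (pSP s ss).2.
split=> // [t t0s|t t0s]; last exact: (pSP t t0s).1.
have t0s' : 0 <= t <= s by case/andP: t0s => /ltW -> /ltW ->.
by apply: is_derive_eq (DS t t0s) _; rewrite -PE.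
Qed.

Lemma cov_flow_bvp (P : 'M[R]_n) (S : R -> 'M[R]_n) :
  P^T = P -> no_escape A G Q s P -> cov_flow A G Q D s P Sigma0 S -> S s = Sigmaf ->
  bvp_solution A B D Q Rw Sigma0 Sigmaf s S (fun t => riccati A G Q (s - t) P).
Proof.
move=> sP gP [Sc DS SE pS] Ss.
have hQ := pQ.1; have hG := control_weight_psd.1.
have good_t t : 0 <= t <= s -> 0 <= s - t <= s.
  by move=> /andP[t0 ts]; rewrite subr_ge0 ts gerBl.
split=> //.
- split=> //; apply: (@within_continuous_reflect _ _ (fun t => riccati A G Q t P)).
  by rewrite subrr subr0; exact: within_riccati.
- move=> t t0s; split; first exact: pS.
  by apply: riccati_sym => //; apply: gP; exact: good_t.
- move=> t t0s; have t0s' : 0 <= t <= s by case/andP: t0s => /ltW -> /ltW ->.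
  apply: is_derive_eq (is_derive_riccati_backward gP (good_t t t0s')) _.
  by rewrite /riccati_field !opprD opprK /G !mulmxA.
Qed.

End BoundaryValueProblem.

(** * Regularity of the dual functional *)

Section DualValue.
Variables (R : realType) (n : nat) (A G Q D : 'M[R]_n) (varpi : R).
Hypotheses (pG : mx_psd G) (pQ : mx_psd Q) (pD : mx_psd D).
Variables (S0 Sf : 'M[R]_n).
Hypotheses (pS0 : mx_posdef S0) (pSf : mx_posdef Sf).

Local Notation p := (riccati A G Q).
Local Notation good := (no_escape A G Q).
Local Notation dual := (dual_value A G Q D varpi S0 Sf).
Local Notation ham S P := (riccati_hamiltonian A G Q D varpi S P).

Let hG := pG.1.
Let hQ := pQ.1.

Lemma riccati_hamiltonian_cvg (T : Type) (F : set_system T) {FF : Filter F}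
    (f g : T -> 'M[R]_n) (S P : 'M[R]_n) :
  f x @[x --> F] --> S -> g x @[x --> F] --> P ->
  ham (f x) (g x) @[x --> F] --> ham S P.
Proof.
move=> fS gP; apply: cvgD; last first.
  by apply: cvg_mxtrace; apply: cvg_mulmx => //; exact: cvg_cst.
apply: cvgD; first exact: cvg_cst.
apply: cvg_mxtrace; apply: cvg_mulmx => //.
apply: cvgB; last first.
  by apply: cvg_mulmx => //; apply: cvg_mulmx => //; exact: cvg_cst.
apply: cvgD; last by apply: cvg_mulmx => //; exact: cvg_cst.
by apply: cvgD; [exact: cvg_cst|apply: cvg_mulmx => //; exact: cvg_cst].
Qed.

Lemma riccati_hamiltonian_bounded (S : 'M[R]_n) (c : R) : exists2 L : R, 0 < L &
  forall P, `|P| <= c -> `|ham S P| <= L.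
Proof.
have hc : continuous (fun P : 'M[R]_n => ham S P).
  move=> P; apply: (@riccati_hamiltonian_cvg _ (nbhs P) _ (fun=> S) id) => //.
  exact: cvg_cst.
have [L [_ HL]] := compact_bounded
  (continuous_compact (continuous_subspaceT hc) (@mx_ball_compact R n n 0 c)).
exists (`|L| + 1); first by rewrite ltr_wpDl.
move=> P Pc; apply: (HL (`|L| + 1)); first by rewrite ltr_pwDr// ler_norm.
by exists P => //=; rewrite subr0.
Qed.

(** Lengthening the horizon at fixed terminal co-state moves only the initial one, [p t P]; this is
    how the Hamiltonian at the initial time becomes the slope in the final time. *)
Lemma dual_value_derive (s : R) (P S : 'M[R]_n) : 0 < s -> good s P ->
  {within `[0, s], continuous (dual_value A G Q D varpi S Sf ^~ P)} /\
  forall t : R, 0 < t < s ->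
    is_derive t 1 (dual_value A G Q D varpi S Sf ^~ P) (ham S (p t P)).
Proof.
move=> s0 gP; have [_ Ic DI] := dual_integralP D s0 gP; split=> [t|t t0s].
  apply: cvgD; last exact: Ic.
  apply: cvgD; last first.
    apply: cvgM; first exact: cvg_cst.
    by apply: continuous_subspaceT => u; exact: cvg_id.
  apply: cvgB; last exact: cvg_cst.
  apply: cvg_mxtrace; apply: cvg_mulmx; last exact: cvg_cst.
  exact: (within_riccati gP).
have t0s' : 0 <= t <= s by case/andP: t0s => /ltW -> /ltW ->.
have Dp := is_derive_riccati (gP t t0s'); have DIt := DI t t0s.
apply: is_derive_eq; rewrite mulmx0 !addr0 /riccati_hamiltonian.
by rewrite [varpi%:A]mulr1 [X in X + _]addrC.
Qed.

(** The constant is uniform over a ball of terminal values: Riccati solutions starting there are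
    bounded by [c + C * rho], which bounds the slope. *)
Lemma dual_value_time_lipschitz (s : R) (P0 : 'M[R]_n) :
  0 < s -> P0^T = P0 -> good s P0 ->
  exists rho L d : R, [/\ 0 < rho, 0 < L, 0 < d, d < s & forall P u,
    `|P - P0| <= rho -> `|u - s| <= d ->
    good u P /\ `|dual u P - dual s P| <= L * `|u - s|].
Proof.
move=> s0 sP0 gP0; have [s1 ss1 gs1] := no_escape_extend (ltW s0) gP0.
have s10 : 0 < s1 by exact: lt_trans ss1.
have [rho [C [rho0 C0 HC]]] := riccati_lipschitz hG hQ (ltW s10) sP0 gs1.
have [c c0 Hc] := within_continuous_bounded (within_riccati gs1).
have [L L0 HL] := riccati_hamiltonian_bounded S0 (c + C * rho).
(* The first bound keeps [u] inside the enlarged horizon [s1], the second keeps it positive. *)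
pose d := Num.min (s1 - s) (s / 2).
have d_s1 : d <= s1 - s by rewrite ge_min lexx.
have d_s2 : d <= s / 2 by rewrite ge_min lexx orbT.
exists rho, L, d; split=> //.
- by rewrite lt_min subr_gt0 ss1 divr_gt0.
- by lra.
move=> P u Prho; rewrite ler_norml => /andP[ud1 ud2].
have [gP lip] := HC P Prho.
have us1 : u <= s1 by lra.
have u0 : 0 < u by lra.
split; first exact: no_escapeW gP.
have [Dc DD] := dual_value_derive S0 s10 gP.
have mono a b : 0 < a -> a <= b -> b <= s1 -> `|dual b P - dual a P| <= L * (b - a).
  move=> a0 ab bs; have sub : `[a, b] `<=` `[0, s1].
    by apply: subset_itv; rewrite bnd_simp// ltW.
  apply: (@derive_bounded_lipschitz _ (dual ^~ P) (fun t => ham S0 (p t P)) a b L ab).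
  - exact: continuous_subspaceW Dc.
  - by move=> t /andP[at_ tb]; apply: DD; rewrite (lt_trans a0)// (lt_le_trans tb).
  - move=> t /andP[at_ tb]; apply: HL.
    have ts : 0 <= t <= s1 by rewrite (ltW (lt_trans a0 at_)) (ltW (lt_le_trans tb bs)).
    rewrite -[p t P](subrK (p t P0)) addrC (le_trans (ler_normD _ _))// lerD//.
      exact: Hc.
    by rewrite (le_trans (lip t ts))// ler_wpM2l// ltW.
have [su|us] := leP s u.
  by rewrite [X in L * X]ger0_norm ?subr_ge0//; exact: mono.
rewrite distrC [X in L * X]distrC [X in L * X]ger0_norm ?subr_ge0 ?(ltW us)//.
by apply: mono => //; exact: ltW.
Qed.

Lemma dual_value_continuous (s e : R) (P0 : 'M[R]_n) : 0 < s ->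
  let K := [set P : 'M[R]_n | P^T = P /\ `|P - P0| <= e] in
  (forall P, K P -> good s P) -> {within K, continuous (dual s)}.
Proof.
move=> s0 K gK.
suff dual_c (P1 : 'M[R]_n) : K P1 ->
    dual s P @[P --> within K (nbhs P1)] --> dual s P1.
  exact/subspace_continuousP.
move=> KP1; have [sP1 _] := KP1.
have [S1 fS1] := cov_flow_exists pD s0 (gK P1 KP1) pS0.
have [rho [C [rho0 C0 HC]]] := dual_value_gap varpi pG pQ s0 sP1 (gK P1 KP1) fS1 Sf.
have dc : P1 - P @[P --> nbhs P1] --> (0 : 'M[R]_n).
  have : P1 - P @[P --> nbhs P1] --> P1 - P1.
    by apply: cvgB; [exact: cvg_cst|exact: cvg_id].
  by rewrite subrr.
have trc : \tr ((P1 - P) *m (S1 s - Sf)) @[P --> nbhs P1] --> (0 : R).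
  rewrite -(mxtrace0 R n) -(mul0mx n (S1 s - Sf)).
  by apply: cvg_mxtrace; apply: cvg_mulmx => //; exact: cvg_cst.
have nd (r : R) : 0 < r -> \forall P \near P1, `|P - P1| <= r.
  move=> r0; move/cvgrPdist_le : dc => /(_ r r0); apply: filterS => P.
  by rewrite sub0r normrN distrC.
have nt (r : R) : 0 < r -> \forall P \near P1, `|\tr ((P1 - P) *m (S1 s - Sf))| <= r.
  move=> r0; move/cvgrPdist_le : trc => /(_ r r0); apply: filterS => P.
  by rewrite sub0r normrN.
apply/cvgrPdist_le => e' e'0; rewrite near_withinE.
have e20 : 0 < e' / 2 by rewrite divr_gt0.
near=> P => KP; have [sP _] := KP.
have Prho : `|P - P1| <= rho.
  by near: P; exact: nd.
have [_ gap] := HC P sP Prho.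
have t1 : `|\tr ((P1 - P) *m (S1 s - Sf))| <= e' / 2.
  by near: P; exact: nt.
have t2 : C * `|P - P1| ^+ 2 <= e' / 2.
  have d1 : `|P - P1| <= 1.
    by near: P; exact: nd.
  have d2 : `|P - P1| <= e' / 2 / C.
    by near: P; apply: nd; rewrite divr_gt0.
  rewrite -ler_pdivlMl// mulrC (le_trans _ d2)// expr2 ler_piMl//.
rewrite -[dual s P1 - dual s P](subrK (\tr ((P1 - P) *m (S1 s - Sf)))) [e']splitr.
rewrite (le_trans (ler_normD _ _))// lerD//.
exact: le_trans gap _.
Unshelve. all: by end_near. Qed.

(* At a local maximiser the first-order term of [dual_value_gap] vanishes in
   the direction [S s - Sf], so the driven covariance hits its target. *)
Lemma dual_value_critical (s r : R) (P1 : 'M[R]_n) (S1 : R -> 'M[R]_n) :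
  0 < s -> 0 < r -> P1^T = P1 -> good s P1 -> cov_flow A G Q D s P1 S0 S1 ->
  (forall P2, P2^T = P2 -> `|P2 - P1| <= r -> dual s P2 <= dual s P1) ->
  S1 s = Sf.
Proof.
move=> s0 r0 sP1 gP1 fS1 maxP1.
have [rho [C [rho0 C0 HC]]] := dual_value_gap varpi pG pQ s0 sP1 gP1 fS1 Sf.
have ss : 0 <= s <= s by rewrite lexx ltW.
pose M := S1 s - Sf; have sM : M^T = M.
  by have [_ _ _ /(_ s ss)[sS1 _]] := fS1; rewrite linearB /= sS1 pSf.1.
apply/eqP; rewrite -subr_eq0 -/M -normr_eq0; apply/negPn/negP => M0.
have q0 : 0 < `|M| by rewrite lt_neqAle eq_sym M0 normr_ge0.
set q := `|M| in M0 q0.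
(* The step [e *: M] stays in both balls, and [C * e < 1] makes the remainder [C * (e * q) ^+ 2]
   smaller than the first-order gain, at least [e * q ^+ 2]. *)
pose e := Num.min (Num.min rho r / q) (C + 1)^-1.
have C10 : 0 < C + 1 by rewrite addr_gt0.
have e0 : 0 < e by rewrite lt_min invr_gt0 C10 divr_gt0// lt_min rho0.
have eC : e * (C + 1) <= 1.
  by rewrite -ler_pdivlMr// mul1r ge_min lexx orbT.
have eq_min : e * q <= Num.min rho r by rewrite -ler_pdivlMr// ge_min lexx.
have dP : P1 + e *: M - P1 = e *: M by rewrite addrC addKr.
have dP' : P1 - (P1 + e *: M) = - (e *: M) by rewrite opprD addrA subrr sub0r.
have sP2 : (P1 + e *: M)^T = P1 + e *: M by rewrite linearD linearZ /= sP1 sM.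
have nP : `|P1 + e *: M - P1| = e * q by rewrite dP normrZ gtr0_norm.
have Prho : `|P1 + e *: M - P1| <= rho.
  by rewrite nP (le_trans eq_min)// ge_min lexx.
have Pr : `|P1 + e *: M - P1| <= r.
  by rewrite nP (le_trans eq_min)// ge_min lexx orbT.
have [_] := HC _ sP2 Prho; have := maxP1 _ sP2 Pr.
rewrite nP -/M dP' mulNmx mxtraceN -scalemxAl mxtraceZ opprK => le12.
rewrite ler_norml => /andP[_ gap].
have qM : q ^+ 2 <= \tr (M *m M) by have := mx_normr_sqr_le M; rewrite sM.
have : e * \tr (M *m M) <= C * (e * q) ^+ 2.
  by move: le12 gap; move: (dual s P1) (dual s _) => x y *; lra.
have : e * q ^+ 2 <= e * \tr (M *m M) by rewrite ler_wpM2l// ltW.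
move=> h1 h2; have := le_trans h1 h2; apply/negP; rewrite -ltNge.
have -> : C * (e * q) ^+ 2 = (C * e) * (e * q ^+ 2) by ring.
rewrite gtr_pMl ?mulr_gt0 ?exprn_gt0//.
by rewrite (lt_le_trans _ eC)// mulrDr mulr1 mulrC ltrDl.
Qed.

End DualValue.

(** * Dependence on the final time *)

Section OptimalFamily.
Variables (R : realType) (n : nat) (A G Q D : 'M[R]_n) (varpi : R).
Hypotheses (pG : mx_psd G) (pQ : mx_psd Q) (pD : mx_psd D).
Hypothesis G_eq0 : forall E : 'M[R]_n, E^T = E -> E *m G *m E = 0 -> G *m E = 0.
Variables (S0 Sf : 'M[R]_n).
Hypotheses (pS0 : mx_posdef S0) (pSf : mx_posdef Sf).

Local Notation p := (riccati A G Q).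
Local Notation good := (no_escape A G Q).
Local Notation dual := (dual_value A G Q D varpi S0 Sf).
Local Notation ham S P := (riccati_hamiltonian A G Q D varpi S P).
Local Notation flow := (cov_flow A G Q D).

(* [T s] is the terminal co-state and [Sg s] the covariance trajectory of the
   problem with final time [s]. *)
Variables (T : R -> 'M[R]_n) (Sg : R -> R -> 'M[R]_n).
Hypothesis T_sym : forall s, 0 < s -> (T s)^T = T s.
Hypothesis T_good : forall s, 0 < s -> good s (T s).
Hypothesis Sg_flow : forall s, 0 < s -> flow s (T s) S0 (Sg s).
Hypothesis Sg_end : forall s, 0 < s -> Sg s s = Sf.
Hypothesis T_unique : forall s P S, 0 < s -> P^T = P -> good s P ->
  flow s P S0 S -> S s = Sf -> P = T s.

Let cost (s : R) : R := dual s (T s).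

Lemma dual_le_cost s P : 0 < s -> P^T = P -> good s P -> dual s P <= cost s.
Proof.
move=> s0 sP gP.
exact: (dual_value_le varpi pG pQ s0 (T_sym s0) (T_good s0) (Sg_flow s0) (Sg_end s0)).
Qed.

(** In case of equality the difference [E] of the two Riccati solutions satisfies [G E = 0]: both
    co-states give the same closed loop. Then [Sg s] is also the covariance driven by [P], it ends
    at [Sf], and uniqueness gives [P = T s]. *)
Lemma dual_lt_cost s P : 0 < s -> P^T = P -> good s P -> P != T s -> dual s P < cost s.
Proof.
move=> s0 sP gP nP; rewrite lt_neqAle dual_le_cost// andbT.
apply: contra nP => /eqP Deq; apply/eqP.
have EGE := dual_value_eq pG pQ s0 (T_sym s0) (T_good s0) (Sg_flow s0) (Sg_end s0)
  sP gP Deq.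
have [Sc DS SE pS] := Sg_flow s0.
suff fl : flow s P S0 (Sg s) by exact: T_unique s0 sP gP fl (Sg_end s0).
split; [exact: Sc| |exact: SE|exact: pS] => t t0s; have ts : 0 <= s - t <= s.
  by case/andP: t0s => t0 ts; rewrite subr_ge0 (ltW ts) gerBl ltW.
have -> : G *m p (s - t) P = G *m p (s - t) (T s); last exact: DS.
apply/eqP; rewrite eq_sym -subr_eq0 -mulmxBr; apply/eqP.
apply: G_eq0; last exact: EGE.
have sp1 := riccati_sym pG.1 pQ.1 (T_sym s0) (T_good s0 ts).
have sp2 := riccati_sym pG.1 pQ.1 sP (gP _ ts).
by rewrite linearB /= sp1 sp2.
Qed.

(** Compactness makes strict maximality at [T s] quantitative: on the boundary shell [K'] the dual
    at time [s] stays below the cost by a fixed [g], more than the values can drift when the time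
    moves from [s] to [u]. *)
Lemma terminal_costate_continuous (s e : R) : 0 < s -> 0 < e ->
  exists2 d : R, 0 < d & forall u, `|u - s| <= d -> 0 < u /\ `|T u - T s| <= e.
Proof.
have no_gap (x1 x2 x3 x4 g : R) : x1 <= x2 -> `|x1 - x4| <= g / 3 ->
    `|x2 - x3| <= g / 3 -> g <= x4 - x3 -> 0 < g -> False.
  rewrite !ler_norml => h1 /andP[h2 h3] /andP[h4 h5] h6 h7; lra.
move=> s0 e0.
have [rho [L [d1 [rho0 L0 d10 d1s HL]]]] :=
  dual_value_time_lipschitz D varpi pG pQ S0 Sf s0 (T_sym s0) (T_good s0).
pose r := Num.min e rho; have r0 : 0 < r by rewrite lt_min e0.
have rr : r <= rho by rewrite ge_min lexx orbT.
pose K := [set P : 'M[R]_n | P^T = P /\ `|P - T s| <= r].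
have K_good P u : K P -> `|u - s| <= d1 -> good u P.
  by move=> [_ Pr] us; have [] := HL P u (le_trans Pr rr) us.
have sym_closed : closed [set P : 'M[R]_n | P^T = P].
  have -> : [set P : 'M[R]_n | P^T = P] = (fun P => P^T - P) @^-1` [set 0].
    apply/seteqP; split=> P /=; first by move=> ->; rewrite subrr.
    by move=> /eqP; rewrite subr_eq0 => /eqP.
  apply: (@preimage_closed _ _ (fun P : 'M[R]_n => P^T - P)); last first.
    by apply/accessible_closed_set1/hausdorff_accessible; exact: norm_hausdorff.
  move=> P _; suff H (N : 'M[R]_n) : M^T - M @[M --> nbhs N] --> N^T - N by exact: H.
  have idN : M @[M --> nbhs N] --> N by exact: cvg_id.
  exact: (cvgB (cvg_trmx idN) idN).
have cK : compact K.
  have -> : K = [set P | P^T = P] `&` [set P | `|P - T s| <= r] by [].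
  apply: (@subclosed_compact _ _ [set P | `|P - T s| <= r]).
  - apply: closedI => //; apply: compact_closed; [exact: norm_hausdorff|exact: mx_ball_compact].
  - exact: mx_ball_compact.
  - by move=> P [].
pose K' := K `&` [set P : 'M[R]_n | r <= `|P - T s|].
have cK' : compact K'.
  apply: (@subclosed_compact _ _ K) => //; last by move=> P [].
  apply: closedI; first by apply: compact_closed => //; exact: norm_hausdorff.
  apply: (@preimage_closed _ _ (fun P : 'M[R]_n => `|P - T s|) [set x : R | r <= x]);
    last exact: closed_ge.
  move=> P _; suff H (N : 'M[R]_n) : `|M - T s| @[M --> nbhs N] --> `|N - T s|.
    exact: H.
  by apply: cvg_norm; apply: cvgB; [exact: cvg_id|exact: cvg_cst].
have dual_c u : 0 < u -> `|u - s| <= d1 -> {within K, continuous (dual u)}.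
  by move=> u0 us; apply: dual_value_continuous => // P KP; exact: K_good us.
have ss : `|s - s| <= d1 by rewrite subrr normr0 ltW.
have [g g0 Hg] : exists2 g : R, 0 < g & forall P, K' P -> g <= cost s - dual s P.
  apply: compact_continuous_pos => //.
    move=> P; apply: cvgB; first exact: cvg_cst.
    have sub : K' `<=` K by move=> ? [].
    exact: (continuous_subspaceW sub (dual_c s s0 ss)).
  move=> P [KP rP]; rewrite subr_gt0; apply: dual_lt_cost => //.
  - by have [] := KP.
  - exact: K_good KP ss.
  - by apply: contraTneq rP => ->; rewrite subrr normr0 -ltNge.
(* Each dual value drifts by at most [g / 3]; the two drifts compared, at [T s] and at the new
   maximiser, cannot make up for [g]. *)
pose d := Num.min d1 (g / (3 * L)).
have d_d1 : d <= d1 by rewrite ge_min lexx.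
have d_g : L * d <= g / 3.
  rewrite mulrC -ler_pdivlMr// (le_trans (_ : d <= g / (3 * L))) ?ge_min ?lexx ?orbT//.
  by rewrite invfM mulrA.
exists d; first by rewrite lt_min d10 divr_gt0// mulr_gt0.
move=> u ud; have ud1 := le_trans ud d_d1.
have u0 : 0 < u.
  move: ud1; rewrite ler_norml => /andP[+ _]; rewrite lerBrDr; apply: lt_le_trans.
  by rewrite addrC subr_gt0.
split=> //; have KTs : K (T s).
  by split; [exact: T_sym|rewrite subrr normr0 ltW].
have [|Ph] := compact_EVT_max _ cK (dual_c u u0 ud1); first by exists (T s).
rewrite inE => KPh maxPh; have [sPh Phr] := KPh.
have timeL P : K P -> `|dual u P - dual s P| <= g / 3.
  move=> [_ Pr]; have [_ H] := HL P u (le_trans Pr rr) ud1.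
  by rewrite (le_trans H)// (le_trans _ d_g)// ler_wpM2l// ltW.
have Phr' : `|Ph - T s| < r.
  rewrite ltNge; apply/negP => rPh; have := Hg Ph (conj KPh rPh).
  have := timeL _ KPh; have := timeL _ KTs; have : dual u (T s) <= dual u Ph.
    by apply: maxPh; rewrite inE.
  move=> h1 h2 h3 h4; exact: no_gap h1 h2 h3 h4 g0.
have gPh := K_good _ _ KPh ud1.
have [S1 fS1] := cov_flow_exists pD u0 gPh pS0.
have -> : T u = Ph; last by rewrite (le_trans Phr)// ge_min lexx.
apply/esym; apply: (T_unique u0 sPh gPh fS1).
have r'0 : 0 < r - `|Ph - T s| by rewrite subr_gt0.
apply: (dual_value_critical pG pQ pSf u0 r'0 sPh gPh fS1) => P2 sP2 P2r.
apply: maxPh; rewrite inE; split=> //.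
rewrite -[P2](subrK Ph) -addrA (le_trans (ler_normD _ _))//.
by rewrite -lerBrDr.
Qed.

(** Each optimal co-state is tested at the other time: [dual u (T s) <= cost u] and
    [dual s (T u) <= cost s], both tests being Lipschitz in time once [T u] is close to [T s]. *)
Lemma cost_continuous (s : R) : 0 < s -> {for s, continuous cost}.
Proof.
have near_eq (x1 x2 x3 c1 c2 e : R) : x1 <= c2 -> `|x1 - c1| <= e ->
    x2 <= c1 -> `|c2 - x2| <= e -> `|c1 - c2| <= e.
  rewrite !ler_norml => h1 /andP[h2 h3] h4 /andP[h5 h6]; lra.
move=> s0; have [rho [L [d1 [rho0 L0 d10 d1s HL]]]] :=
  dual_value_time_lipschitz D varpi pG pQ S0 Sf s0 (T_sym s0) (T_good s0).
have [d2 d20 Hd2] := terminal_costate_continuous s0 rho0.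
apply/cvgrPdist_le => e e0.
pose d := Num.min d1 (Num.min d2 (e / L)).
have d0 : 0 < d by rewrite !lt_min d10 d20 divr_gt0.
suff key u : `|s - u| < d -> `|cost s - cost u| <= e.
  by apply/nbhs_ballP; exists d => // u; exact: key.
rewrite distrC !lt_min => /and3P[/ltW ud1 /ltW ud2 /ltW udL].
have Lu : L * `|u - s| <= e by rewrite mulrC -ler_pdivlMr.
have [u0 Tu] := Hd2 u ud2.
have ss : `|s - s| <= d1 by rewrite subrr normr0 ltW.
have Ts0 : `|T s - T s| <= rho by rewrite subrr normr0 ltW.
have [gu lipu] := HL (T s) u Ts0 ud1.
have [_ lipTu] := HL (T u) u Tu ud1; have [gs _] := HL (T u) s Tu ss.
apply: (near_eq (dual u (T s)) (dual s (T u)) 0).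
- by apply: dual_le_cost => //; exact: T_sym.
- exact: le_trans lipu Lu.
- by apply: dual_le_cost => //; exact: T_sym.
- exact: le_trans lipTu Lu.
Qed.

(** Evaluated at the final time, where the covariance is the fixed [Sf], so that it depends on [s]
    through [T s] alone. *)
Let energy (s : R) : R := ham Sf (T s).

Lemma hamiltonian_along_flow s t : 0 < s -> 0 <= t <= s ->
  ham (Sg s t) (p (s - t) (T s)) = energy s.
Proof.
move=> s0 t0s.
have hc u (us : 0 <= u <= s) := riccati_hamiltonian_const varpi pG pQ (T_sym s0)
  (T_good s0) (Sg_flow s0) us.
have ss : 0 <= s <= s by rewrite lexx ltW.
have := hc s ss; rewrite /= subrr riccati0 Sg_end// /energy => ->.
exact: hc.
Qed.

Lemma energy_continuous (s : R) : 0 < s -> {for s, continuous energy}.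
Proof.
move=> s0; apply: riccati_hamiltonian_cvg; first exact: cvg_cst.
apply/cvgrPdist_le => e e0; have [d d0 Hd] := terminal_costate_continuous s0 e0.
suff key u : `|s - u| < d -> `|T s - T u| <= e.
  by apply/nbhs_ballP; exists d => // u; exact: key.
by rewrite distrC => /ltW/Hd[_]; rewrite distrC.
Qed.

(* The dual value at the fixed co-state [T s] touches the cost from below at
   [s], with slope given by the Hamiltonian. *)
Lemma cost_touching (s : R) : 0 < s -> exists2 d : R, 0 < d &
  is_derive s 1 (dual ^~ (T s)) (energy s) /\
  forall u, 0 < u < s + d -> dual u (T s) <= cost u.
Proof.
move=> s0; have [s1 ss1 gs1] := no_escape_extend (ltW s0) (T_good s0).
have s10 : 0 < s1 by exact: lt_trans ss1.
exists (s1 - s); first by rewrite subr_gt0.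
split.
  have [_ DD] := dual_value_derive D varpi Sf S0 s10 gs1.
  have ss : 0 < s < s1 by rewrite s0.
  have s0s : 0 <= (0 : R) <= s by rewrite lexx ltW.
  rewrite -(hamiltonian_along_flow s0 s0s) subr0.
  by have [_ _ -> _] := Sg_flow s0; exact: DD.
move=> u; rewrite subrKC => /andP[u0 us].
by apply: dual_le_cost => //; [exact: T_sym|exact: no_escapeW (ltW us) gs1].
Qed.

(** * Monotonicity of the cost when the Hamiltonian keeps a sign *)

Lemma cost_within_continuous a b : 0 < a -> {within `[a, b], continuous cost}.
Proof.
move=> a0; apply: continuous_in_subspaceT => t; rewrite inE /= in_itv /= => /andP[at_ _].
by apply: cost_continuous; exact: lt_le_trans at_.
Qed.

(** A maximum point [c < b] of the cost on [a, b] is impossible: the function touching from below at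
    [c] has positive slope, so the cost exceeds [cost c] just to the right. [cost_nincr] is the
    mirror image, looking to the left. *)
Lemma cost_ndecr (a b : R) : (forall s : R, 0 < s -> 0 < energy s) ->
  0 < a -> a <= b -> cost a <= cost b.
Proof.
move=> e0 a0 ab; have [c cab cmax] := EVT_max ab (cost_within_continuous (b := b) a0).
move: cab; rewrite in_itv /= => /andP[ac cb].
have c0 : 0 < c by exact: lt_le_trans ac.
suff cbE : c = b by rewrite -cbE; apply: cmax; rewrite in_itv /= lexx.
apply/eqP; rewrite eq_le cb /= leNgt; apply/negP => cltb.
have [d d0 [Dd touch]] := cost_touching c0.
have [d' d'0 incr] := derive_pos_near Dd (e0 c c0).
pose h := Num.min (Num.min d d') (b - c) / 2.
have hm : 0 < Num.min (Num.min d d') (b - c) by rewrite !lt_min d0 d'0 subr_gt0.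
have h0 : 0 < h by rewrite divr_gt0.
have hlt : h < Num.min (Num.min d d') (b - c) by rewrite ltr_pdivrMr// mulr_natr mulr2n ltrDl.
move: hlt; rewrite !lt_min => /andP[/andP[hd hd'] hb].
have ch0 : c < c + h by rewrite ltrDl.
have cu : cost c < cost (c + h).
  apply: (lt_le_trans (incr (c + h) _)); first by rewrite ch0 ltrD2l.
  by apply: touch; rewrite ltrD2l hd andbT (lt_trans c0).
have : cost (c + h) <= cost c.
  by apply: cmax; rewrite in_itv /= (le_trans ac (ltW ch0)) -lerBrDl ltW.
by rewrite leNgt cu.
Qed.

Lemma cost_nincr (a b : R) : (forall s : R, 0 < s -> energy s < 0) ->
  0 < a -> a <= b -> cost b <= cost a.
Proof.
move=> e0 a0 ab; have [c cab cmax] := EVT_max ab (cost_within_continuous (b := b) a0).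
move: cab; rewrite in_itv /= => /andP[ac cb].
have c0 : 0 < c by exact: lt_le_trans ac.
suff caE : c = a by rewrite -caE; apply: cmax; rewrite in_itv /= ab lexx.
apply/eqP; rewrite eq_le ac andbT leNgt; apply/negP => altc.
have [d d0 [Dd touch]] := cost_touching c0.
have [d' d'0 decr] := derive_neg_near Dd (e0 c c0).
pose h := Num.min d' (c - a) / 2.
have hm : 0 < Num.min d' (c - a) by rewrite !lt_min d'0 subr_gt0.
have h0 : 0 < h by rewrite divr_gt0.
have hlt : h < Num.min d' (c - a) by rewrite ltr_pdivrMr// mulr_natr mulr2n ltrDl.
move: hlt; rewrite !lt_min => /andP[hd' ha].
have ch0 : c - h < c by rewrite gtrBl.
have ach : a < c - h by rewrite ltrBrDr -ltrBrDl.
have cu : cost c < cost (c - h).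
  apply: (lt_le_trans (decr (c - h) _)); first by rewrite ch0 ltrD2l ltrN2 hd'.
  by apply: touch; rewrite (lt_trans a0 ach) (lt_trans ch0)// ltrDl.
have : cost (c - h) <= cost c.
  by apply: cmax; rewrite in_itv /= (ltW ach) (le_trans (ltW ch0)).
by rewrite leNgt cu.
Qed.

Lemma cost_blowup (M : R) : S0 <> Sf -> exists s : R, [/\ 0 < s, s <= 1 & M < cost s].
Proof.
move=> neq; pose N := S0 - Sf.
have sN : N^T = N by rewrite linearB /= pS0.1 pSf.1.
have N0 : 0 < \tr (N *m N).
  have := mx_normr_sqr_le N; rewrite sN; apply: lt_le_trans.
  by rewrite exprn_gt0// normr_gt0 subr_eq0; apply/eqP.
(* At horizon 0 the dual value is [tr (P N)], which this scaling makes equal to [|M| + 1];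
   continuity at 0 then costs less than 1. *)
pose lam := (`|M| + 1) / \tr (N *m N).
pose P := lam *: N; have sP : P^T = P by rewrite linearZ /= sN.
have g0 : good 0 P.
  move=> tau t0; have -> : tau = 0 by apply/le_anti; rewrite andbC.
  by rewrite ham_state0 unitmx1.
have [s1 s10 gs1] := no_escape_extend (lexx 0) g0.
have [Dc _] := dual_value_derive D varpi Sf S0 s10 gs1.
have D0 : dual 0 P = `|M| + 1.
  have [I0 _ _] := dual_integralP D s10 gs1.
  rewrite /dual_value riccati0 I0 mulr0 !addr0 -mxtraceB -mulmxBr -/N.
  by rewrite -scalemxAl mxtraceZ divfK// gt_eqF.
have /subspace_continuousP/(_ 0) : {within `[0, s1], continuous (dual ^~ P)} by exact: Dc.
have in0 : `[0, s1]%classic (0 : R) by rewrite /= in_itv /= lexx ltW.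
move=> /(_ in0) /cvgrPdist_lt /(_ 1 ltr01); rewrite near_withinE => /nbhs_ballP[d /= d0 Hd].
pose s := Num.min (Num.min d s1) 1 / 2.
have sm : 0 < Num.min (Num.min d s1) 1 by rewrite !lt_min d0 s10 ltr01.
have s0 : 0 < s by rewrite divr_gt0.
have : s < Num.min (Num.min d s1) 1 by rewrite ltr_pdivrMr// mulr_natr mulr2n ltrDl.
rewrite !lt_min => /andP[/andP[sd ss1] slt1].
exists s; split=> //; first exact: ltW.
apply: (lt_le_trans _ (dual_le_cost s0 sP (no_escapeW (ltW ss1) gs1))).
have bs : ball 0 d s by rewrite /ball /= sub0r normrN gtr0_norm.
have is_ : `[0, s1]%classic s by rewrite /= in_itv /= !ltW.
have := Hd s bs is_; rewrite /from_subspace /= D0 ltr_norml => /andP[_ h].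
apply: (le_lt_trans (ler_norm M)); move: h; move: (dual s P) => x.
by rewrite ltrBlDr [1 + _]addrC ltrD2r.
Qed.

(** * Lower bounds on the cost over long horizons *)

Local Notation window S S' l P := (dual_value A G Q D varpi S S' l P).

(** With the same covariance at both ends the window functional is 0 at length 0, and its derivative
    in the length is the Hamiltonian, positive for short lengths. Halving the value leaves room for
    perturbing the ends. *)
Lemma window_gain (S P : 'M[R]_n) : 0 < ham S P ->
  exists l w : R, [/\ 0 < l, 0 < w, good l P & w < window S S l P].
Proof.
move=> h0; have g0 : good 0 P.
  move=> tau t0; have -> : tau = 0 by apply/le_anti; rewrite andbC.
  by rewrite ham_state0 unitmx1.
have [s1 s10 gs1] := no_escape_extend (lexx 0) g0.
have [Dc DD] := dual_value_derive D varpi S S s10 gs1.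
have pc : p tau P @[tau --> (0 : R)] --> P.
  rewrite -[X in _ --> X](riccati0 A G Q P).
  apply: (@riccati_cvg _ _ A G Q _ _ _ id 0 P cvg_id).
  by rewrite ham_state0 unitmx1.
have hc : ham S (p tau P) @[tau --> (0 : R)] --> ham S P.
  by apply: riccati_hamiltonian_cvg => //; exact: cvg_cst.
have /nbhs_ballP[d /= d0 Hd] : \forall tau \near (0 : R), 0 < ham S (p tau P).
  exact: (cvgr_gt _ hc).
pose l := Num.min d s1 / 2.
have lm : 0 < Num.min d s1 by rewrite !lt_min d0 s10.
have l0 : 0 < l by rewrite divr_gt0.
have : l < Num.min d s1 by rewrite ltr_pdivrMr// mulr_natr mulr2n ltrDl.
rewrite lt_min => /andP[ld ls1].
have gl : good l P := no_escapeW (ltW ls1) gs1.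
have W0 : window S S 0 P = 0.
  have [I0 _ _] := dual_integralP D s10 gs1.
  by rewrite /dual_value riccati0 I0 mulr0 !addr0 subrr.
have sub : `[0, l] `<=` `[0, s1] by apply: subset_itvl; rewrite bnd_simp ltW.
have Wl : 0 < window S S l P.
  rewrite -{1}W0.
  apply: (@derive_gt0_incr _ (fun t => window S S t P) (fun t => ham S (p t P)) 0 l l0).
  - exact: continuous_subspaceW Dc.
  - by move=> t /andP[t0 tl]; apply: DD; rewrite t0 (lt_trans tl).
  - move=> t /andP[t0 tl]; apply: Hd.
    by rewrite /ball /= sub0r normrN gtr0_norm// (lt_trans tl).
exists l, (window S S l P / 2); split=> //; first by rewrite divr_gt0.
by rewrite ltr_pdivrMr// mulr_natr mulr2n ltrDl.
Qed.

Lemma window_cvg (F : set_system R) {FF : Filter F} (f g : R -> 'M[R]_n)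
    (S S' : 'M[R]_n) l P :
  f x @[x --> F] --> S -> g x @[x --> F] --> S' ->
  window (f x) (g x) l P @[x --> F] --> window S S' l P.
Proof.
move=> fS gS; apply: cvgD; last exact: cvg_cst.
apply: cvgD; last exact: cvg_cst.
by apply: cvgB; apply: cvg_mxtrace; apply: cvg_mulmx => //; exact: cvg_cst.
Qed.

(** The drops of the cost-to-go over [N] adjacent windows telescope; before [a] and after the last
    window the cost-to-go can only decrease further. *)
Lemma cost_ge_windows (s a l w : R) (P : 'M[R]_n) (N : nat) : 0 <= varpi ->
  P^T = P -> 0 < l -> good l P -> 0 <= a -> 0 < s -> a + N%:R * l <= s ->
  (forall k, (k < N)%N ->
    w <= window (Sg s (a + k%:R * l)) (Sg s (a + k.+1%:R * l)) l P) ->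
  N%:R * w <= cost s.
Proof.
move=> v0 sP l0 gP a0 s0 aNs Hw.
pose psi := cost_to_go A G Q D varpi s (T s) (Sg s).
have psi_nincr u v : 0 <= u -> u <= v -> v <= s -> psi v <= psi u.
  exact: (cost_to_go_nincr pG pQ s0 (T_sym s0) (T_good s0) (Sg_flow s0) v0).
have costE : cost s = psi 0 - psi s.
  have [I0 _ _] := dual_integralP D s0 (T_good s0).
  have [_ _ SE _] := Sg_flow s0.
  rewrite /psi /cost_to_go /cost /dual_value subr0 subrr riccati0 I0 SE Sg_end//.
  by rewrite mulr0 subr0 addr0; ring.
have step k : (k <= N)%N -> k%:R * w <= psi a - psi (a + k%:R * l).
  elim: k => [_|k IHk kN]; first by rewrite !mul0r addr0 subrr.
  have kE : a + k.+1%:R * l = a + k%:R * l + l by rewrite -natr1 mulrDl mul1r addrA.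
  have kl0 : 0 <= k%:R * l by rewrite mulr_ge0// ltW.
  have c0 : 0 <= a + k%:R * l by rewrite addr_ge0.
  have cs : a + k.+1%:R * l <= s.
    by rewrite (le_trans _ aNs)// lerD2l ler_wpM2r ?(ltW l0)// ler_nat.
  have cc : a + k%:R * l < a + k.+1%:R * l by rewrite kE ltrDl.
  have bl : a + k.+1%:R * l - (a + k%:R * l) = l by rewrite kE addrC addKr.
  have gl : good (a + k.+1%:R * l - (a + k%:R * l)) P by rewrite bl.
  have := cost_to_go_window varpi pG pQ s0 (T_sym s0) (T_good s0) (Sg_flow s0)
    c0 cc cs sP gl.
  rewrite bl -/(dual_value A G Q D varpi _ _ l P) -/psi => h1.
  have h2 := le_trans (Hw k kN) h1; have h3 := IHk (ltnW kN).
  rewrite -[in leLHS]natr1 mulrDl mul1r (le_trans (lerD h3 h2))//.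
  by rewrite addrA subrK.
rewrite costE (le_trans (step N (leqnn N)))// lerB//.
  by apply: psi_nincr => //; rewrite (le_trans _ aNs)// lerDl mulr_ge0// ltW.
apply: psi_nincr => //.
by rewrite addr_ge0// mulr_ge0// ltW.
Qed.

(** The order of choices makes pointwise convergence enough: the window length [l], the gain [w] and
    the start [a] come from [Sinf] and [Sstar], then [N] from [M], and only then [s], for which just
    the finitely many times [a + k l] have to be close to their limits. *)
Lemma cost_unbounded (Sstar : R -> 'M[R]_n) (Sinf P : 'M[R]_n) (M : R) :
  0 <= varpi ->
  (forall t, 0 <= t -> Sg s t @[s --> +oo] --> Sstar t) ->
  Sstar t @[t --> +oo] --> Sinf -> P^T = P -> 0 < ham Sinf P ->
  exists s : R, 1 <= s /\ M < cost s.
Proof.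
move=> v0 SgS SS sP h0; have [l [w [l0 w0 gl Wl]]] := window_gain h0.
have SSl : Sstar (t + l) @[t --> +oo] --> Sinf.
  apply: (@cvg_comp _ _ _ (fun t => t + l) Sstar _ _ _ _ SS).
  exact: cvg_addrr.
have := cvgr_gt _ (@window_cvg _ _ _ _ _ _ l P SS SSl) _ Wl.
move=> [t0 [_ Ht0]].
pose a := `|t0| + 1; have a0 : 0 <= a by rewrite addr_ge0.
have Ha t : a <= t -> w < window (Sstar t) (Sstar (t + l)) l P.
  move=> at_; apply: Ht0; apply: lt_le_trans at_.
  by rewrite ltr_pwDr// ler_norm.
have [N HN] : exists N : nat, M < N%:R * w.
  exists (Num.bound `|M / w|); rewrite -ltr_pdivrMr//.
  by rewrite (le_lt_trans (ler_norm _))// archi_boundP.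
have kE (k : nat) : a + k.+1%:R * l = a + k%:R * l + l.
  by rewrite -natr1 mulrDl mul1r addrA.
have near_w : \forall s \near +oo, forall k : 'I_N,
    w < window (Sg s (a + k%:R * l)) (Sg s (a + k.+1%:R * l)) l P.
  apply: filter_forall => k.
  have ak : a <= a + k%:R * l by rewrite lerDl mulr_ge0// ltW.
  have := Ha _ ak; rewrite -(kE k) => Hk.
  have c1 := SgS _ (le_trans a0 ak).
  have c2 : Sg s (a + k.+1%:R * l) @[s --> +oo] --> Sstar (a + k.+1%:R * l).
    by apply: SgS; rewrite (kE k) addr_ge0 ?(ltW l0)// (le_trans a0).
  exact: (cvgr_gt _ (@window_cvg _ _ _ _ _ _ l P c1 c2) _ Hk).
near (pinfty_nbhs R) => s.
have s1 : 1 <= s by near: s; exact: nbhs_pinfty_ge.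
have s0 : 0 < s := lt_le_trans ltr01 s1.
have aNs : a + N%:R * l <= s by near: s; exact: nbhs_pinfty_ge (num_real _).
have Hk : forall k : 'I_N,
    w < window (Sg s (a + k%:R * l)) (Sg s (a + k.+1%:R * l)) l P.
  by near: s; exact: near_w.
exists s; split; first exact: s1.
apply: (lt_le_trans HN (cost_ge_windows v0 sP l0 gl a0 s0 aNs _)) => k kN.
exact: ltW (Hk (Ordinal kN)).
Unshelve. all: by end_near. Qed.

Lemma energy_zero (Sstar : R -> 'M[R]_n) (Sinf P : 'M[R]_n) : S0 <> Sf ->
  0 <= varpi -> (forall t, 0 <= t -> Sg s t @[s --> +oo] --> Sstar t) ->
  Sstar t @[t --> +oo] --> Sinf -> P^T = P -> 0 < ham Sinf P ->
  exists2 s : R, 0 < s & energy s = 0.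
Proof.
move=> neq v0 SgS SS sP h0; apply: contrapT => no_zero.
have e_neq0 s : 0 < s -> energy s != 0.
  by move=> s0; apply: contra_not_neq no_zero => e0; exists s.
have same_sign a b : 0 < a -> a <= b -> 0 < energy a * energy b.
  move=> a0 ab; have b0 := lt_le_trans a0 ab.
  rewrite lt_neqAle eq_sym mulf_neq0 ?e_neq0//= leNgt; apply/negP => ab0.
  have ec : {within `[a, b], continuous energy}.
    apply: continuous_in_subspaceT => t; rewrite inE /= in_itv /= => /andP[at_ _].
    by apply: energy_continuous; exact: lt_le_trans at_.
  have [|c] := IVT ab ec (v := 0).
    have [ea|ea] := leP 0 (energy a).
      have eb : energy b <= 0.
        by rewrite leNgt; apply/negP => eb; move: ab0; rewrite ltNge mulr_ge0// ltW.
      by rewrite ge_min eb orbT le_max ea.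
    have eb : 0 <= energy b.
      rewrite leNgt; apply/negP => eb; move: ab0.
      by rewrite ltNge mulr_le0// ltW.
    by rewrite ge_min (ltW ea) le_max eb orbT.
  rewrite in_itv /= => /andP[ac _] ec0.
  by have := e_neq0 c (lt_le_trans a0 ac); rewrite ec0 eqxx.
have sign1 s : 0 < s -> 0 < energy 1 * energy s.
  move=> s0; have [s1|s1] := leP 1 s; first exact: same_sign.
  by rewrite mulrC same_sign// ltW.
have := e_neq0 1 ltr01; rewrite neq_lt => /orP[e1|e1].
  have eneg s : 0 < s -> energy s < 0.
    by move=> s0; have := sign1 s s0; rewrite nmulr_rgt0.
  have [s [s1 Ms]] := cost_unbounded (cost 1) v0 SgS SS sP h0.
  by have := cost_nincr eneg ltr01 s1; rewrite leNgt Ms.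
have epos s : 0 < s -> 0 < energy s.
  by move=> s0; have := sign1 s s0; rewrite pmulr_rgt0.
have [s [s0 s1 Ms]] := cost_blowup (cost 1) neq.
by have := cost_ndecr epos s0 s1; rewrite leNgt Ms.
Qed.

End OptimalFamily.

(** * The theorem *)

(** [P = 0] gives [varpi + tr (Q S)], positive in the first two cases. Otherwise take a small
    multiple of the Lyapunov residual [M] at [S], which is the gradient in [P] at 0, so the
    first-order gain is [tr (M M)]. *)
Lemma positive_hamiltonian (R : realType) (n : nat) (A G Q D S : 'M[R]_n) (varpi : R) :
  mx_psd G -> mx_psd Q -> mx_psd D -> mx_posdef S -> 0 <= varpi ->
  0 < varpi \/ Q <> 0 \/ A *m S + S *m A^T + D <> 0 ->
  exists P : 'M[R]_n, P^T = P /\ 0 < riccati_hamiltonian A G Q D varpi S P.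
Proof.
move=> pG pQ pD pS v0 cond.
have trQ := mx_psd_trace_mul_ge0 pQ (mx_posdef_psd pS).
have ham0 : riccati_hamiltonian A G Q D varpi S 0 = varpi + \tr (Q *m S).
  rewrite /riccati_hamiltonian /riccati_field.
  by rewrite !(mulmx0, mul0mx, addr0, subr0) mxtrace0 addr0.
have [v1|Qn0|Mn0] : [\/ 0 < varpi, Q <> 0 | A *m S + S *m A^T + D <> 0].
  by case: cond => [|[|]]; [constructor 1|constructor 2|constructor 3].
- by exists 0; rewrite trmx0 ham0 ltr_wpDr.
- have trQ0 : \tr (Q *m S) != 0.
    by apply/negP => /eqP/(mx_psd_posdef_trace_eq0 pQ pS).
  by exists 0; rewrite trmx0 ham0 ltr_wpDl// lt_neqAle trQ eq_sym trQ0.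
pose M := A *m S + S *m A^T + D.
have sM : M^T = M.
  by rewrite /M !linearD /= !trmx_mul trmxK pS.1 pD.1 [X in X + _]addrC.
pose q := \tr (M *m M); pose c := \tr (M *m G *m M *m S).
have q0 : 0 < q.
  have := mx_normr_sqr_le M; rewrite sM; apply: lt_le_trans.
  by rewrite exprn_gt0// normr_gt0; apply/eqP.
have c0 : 0 <= c.
  apply: mx_psd_trace_mul_ge0; last exact: mx_posdef_psd.
  by rewrite -{1}sM; exact: mx_psd_conj.
(* The gain [d * q] has to beat the quadratic loss [d ^+ 2 * c], that is [d * c < q]; the added 1
   also covers [c = 0]. *)
pose d := q / (c + 1); have c10 : 0 < c + 1 by rewrite ltr_wpDl.
have d0 : 0 < d by rewrite divr_gt0.
have dc : d * c < q.
  by rewrite /d mulrAC ltr_pdivrMr// ltr_pM2l// ltrDl.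
have sP : (d *: M)^T = d *: M by rewrite linearZ /= sM.
exists (d *: M); split=> //.
have trM : 2 * \tr (M *m A *m S) + \tr (M *m D) = q.
  rewrite /q {4}/M !mulmxDr !mxtraceD.
  have -> : \tr (M *m (S *m A^T)) = \tr (M *m A *m S).
    by rewrite -mxtrace_tr !trmx_mul trmxK sM pS.1 mxtrace_mulC mulmxA.
  by rewrite [in RHS]mulmxA; ring.
rewrite /riccati_hamiltonian (mxtrace_riccati_field _ _ _ sP pS.1).
rewrite -!scalemxAl -scalemxAr -!scalemxAl !mxtraceZ -/c.
have -> : varpi + (\tr (Q *m S) + 2 * (d * \tr (M *m A *m S)) - d * (d * c)) +
  d * \tr (M *m D) = varpi + \tr (Q *m S) +
  d * ((2 * \tr (M *m A *m S) + \tr (M *m D)) - d * c) by ring.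
by rewrite trM ltr_wpDl ?addr_ge0// mulr_gt0// subr_gt0.
Qed.

Theorem theorem4p1 (R : realType) (n m r : nat)
    (A : 'M[R]_n) (B : 'M[R]_(n, m)) (Gamma : 'M[R]_(n, r)) (D : 'M[R]_n)
    (hD : D = Gamma *m Gamma^T)
    (Q : 'M[R]_n) (hQ : mx_psd Q)
    (Rw : 'M[R]_m) (hRw : mx_posdef Rw)
    (varpi : R) (hvarpi : 0 <= varpi)
    (Sigma0 Sigmaf : 'M[R]_n)
    (hSigma0 : mx_posdef Sigma0) (hSigmaf : mx_posdef Sigmaf)
    (hneq : Sigma0 <> Sigmaf)
    (hctrl : controllable A B)
    (Sigma Pi : R -> R -> 'M[R]_n)
    (hbvp : forall tf : R, 0 < tf ->
      unique_bvp_solution A B D Q Rw Sigma0 Sigmaf tf (Sigma tf) (Pi tf))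
    (hconv : asymptotic_point_convergence Sigma)
    (hcond : 0 < varpi
      \/ (mx_psd Q /\ Q <> 0)
      \/ ~ (exists Sigmas : 'M[R]_n,
              mx_posdef Sigmas /\ A *m Sigmas + Sigmas *m A^T + D = 0)) :
  exists tc : R,
    candidate_free_final_time A B D Q Rw varpi Sigma Pi tc.
Proof.
pose G := B *m invmx Rw *m B^T.
have pG : mx_psd G := control_weight_psd B hRw.
have pD : mx_psd D.
  rewrite hD -[X in X *m _]trmxK -[X in X *m _]mulmx1; apply: mx_psd_conj.
  split; first exact: trmx1.
  move=> x; rewrite mulmx1 mxE; apply: sumr_ge0 => i _.
  by rewrite mxE -expr2 sqr_ge0.
have [Sstar [Sinf [SigS SS pSinf]]] := hconv.
(* [Sinf] is positive definite, so under (c) it cannot solve the Lyapunov equation. *)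
have cond : 0 < varpi \/ Q <> 0 \/ A *m Sinf + Sinf *m A^T + D <> 0.
  case: hcond => [|[[_ Q0]|noS]]; [by left|by right; left|right; right => E].
  by apply: noS; exists Sinf.
have [P [sP hP]] := positive_hamiltonian pG hQ pD pSinf hvarpi cond.
pose T s := Pi s s.
have facts (s : R) (s0 : 0 < s) := bvp_cov_flow s0 (hbvp s s0).1.
have T_sym s : 0 < s -> (T s)^T = T s by move=> /(facts s)[].
have T_good s : 0 < s -> no_escape A G Q s (T s) by move=> /(facts s)[].
have S_flow s : 0 < s -> cov_flow A G Q D s (T s) Sigma0 (Sigma s).
  by move=> /(facts s)[].
have S_end s : 0 < s -> Sigma s s = Sigmaf by move=> /(facts s)[].
have T_unique s P' S : 0 < s -> P'^T = P' -> no_escape A G Q s P' ->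
    cov_flow A G Q D s P' Sigma0 S -> S s = Sigmaf -> P' = T s.
  move=> s0 sP' gP' fS Ss; have ss : 0 <= s <= s by rewrite lexx ltW.
  have [_ /(_ _ _ (cov_flow_bvp hQ hRw sP' gP' fS Ss) s ss)[_ TE]] := hbvp s s0.
  by rewrite /T -TE subrr riccati0.
have [tc tc0 H0] := energy_zero pG hQ pD (control_weight_eq0 hRw) hSigma0 hSigmaf
  T_sym T_good S_flow S_end T_unique hneq hvarpi SigS SS sP hP.
exists tc; split=> // t t0tc; have [_ _ PiE [_ _ _ pS] _] := facts tc tc0.
have ts : 0 <= tc - t <= tc.
  by case/andP: t0tc => t0 ts; rewrite subr_ge0 ts gerBl.
rewrite hamiltonianE; last 2 first.
- rewrite PiE//; apply: (riccati_sym pG.1 hQ.1 (T_sym tc tc0)); exact: T_good.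
- exact: (pS t t0tc).1.
rewrite PiE//.
rewrite (hamiltonian_along_flow varpi pG hQ T_sym T_good S_flow S_end tc0 t0tc).
by rewrite H0 mulr0.
Qed.
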